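(* The set of systems $f\in\mathrm{RDS}(I)$ whose unique stationary probability measure $\mu_f$ on $(0,1)$ has full support is dense in $(\mathrm{RDS}(I),d_m)$.
   Context: Let $I=[0,1]$. Define $h:(0,1)\to\mathbb{R}$ by $h(x)=\log(x)-\log(1/2)$ for $x\in(0,1/2]$ and $h(x)=\log(1/2)-\log(1-x)$ for $x\in[1/2,1)$, and put $d_h(x,y)=|h(x)-h(y)|$. Let $\mathrm{C}(I)$ be the set of continuous functions $f$ from $I$ onto $I$ such that $f(0)=0$, $f(1)=1$, $f((0,1))\subset(0,1)$, and the (one-sided) derivatives $f'(0),f'(1)$ exist and lie in $(0,\infty)$. It carries the metric $d_{\mathrm{C}(I)}(f,g)=\sup_{x\in(0,1)}d_h(f(x),g(x))$ (which is always finite). Let $\mathrm{RDS}(I)$ be the set of triples $f=(f_0,f_1,p_f)\in\mathrm{C}(I)\times\mathrm{C}(I)\times[0,1]$ such that: (i) $f_0,f_1$ are homeomorphisms; (ii) $f_0(x)<x$ for all $x\in(0,1)$; (iii) $f_1(x)>x$ for all $x\in(0,1)$; (iv) $p_f\in(0,1)$; (v) for $j\in\{0,1\}$, $\Lambda_j=p_f\log f_0'(j)+(1-p_f)\log f_1'(j)>0$. It carries the metric $d_m(f,g)=\max\{d_{\mathrm{C}(I)}(f_0,g_0),d_{\mathrm{C}(I)}(f_1,g_1),|p_f-p_g|\}$. A Borel probability measure $\mu$ on $(0,1)$ is stationary for $f\in\mathrm{RDS}(I)$ if $\mu(A)=p_f\,\mu(f_0^{-1}(A))+(1-p_f)\,\mu(f_1^{-1}(A))$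 for every Borel set $A\subset(0,1)$. It is a known fact that each $f\in\mathrm{RDS}(I)$ has exactly one stationary Borel probability measure on $(0,1)$, denoted $\mu_f$. A probability measure $\mu$ on $(0,1)$ has full support if $\mu(U)>0$ for every nonempty open $U\subset(0,1)$. *)

(* Defs.v *)
From HB Require Import structures.
From mathcomp Require Import all_boot all_order all_algebra.
From mathcomp Require Import all_classical all_reals all_analysis.

Set Implicit Arguments.
Unset Strict Implicit.
Unset Printing Implicit Defensive.

Import Order.TTheory GRing.Theory Num.Theory.
Import numFieldNormedType.Exports.

Local Open Scope classical_set_scope.
Local Open Scope ring_scope.

(* A self-map of I = [0, 1] is represented by a function R -> R whose values
   outside I are arbitrary; no definition below depends on these values. *)

Definition I01 (R : realType) : set R := `[0, 1]%classic.
Definition O01 (R : realType) : set R := `]0, 1[%classic.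
Arguments I01 : clear implicits.
Arguments O01 : clear implicits.

Definition hfun (R : realType) (x : R) : R :=
  if x <= 2^-1 then ln x - ln 2^-1 else ln 2^-1 - ln (1 - x).

Definition dh (R : realType) (x y : R) : R := `|hfun x - hfun y|.

Definition dquot (R : realType) (f : R -> R) (a x : R) : R :=
  (f x - f a) / (x - a).

(* The one-sided derivatives f'(0) and f'(1); as [lim] is total, the existence
   of the limits is asserted separately in [is_CI]. *)
Definition derive_at0 (R : realType) (f : R -> R) : R :=
  lim (dquot f 0 x @[x --> 0^'+]).

Definition derive_at1 (R : realType) (f : R -> R) : R :=
  lim (dquot f 1 x @[x --> 1^'-]).

Record is_CI (R : realType) (f : R -> R) : Prop := IsCI {
  CI_continuous : {within I01 R, continuous f};
  CI_onto : f @` (I01 R) = I01 R;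
  CI_0 : f 0 = 0;
  CI_1 : f 1 = 1;
  CI_interior : f @` (O01 R) `<=` O01 R;
  CI_derivable0 : cvg (dquot f 0 x @[x --> 0^'+]);
  CI_derivable1 : cvg (dquot f 1 x @[x --> 1^'-]);
  CI_derive0_gt0 : 0 < derive_at0 f;
  CI_derive1_gt0 : 0 < derive_at1 f
}.

Record CI (R : realType) := MkCI {
  CI_fun :> R -> R;
  CI_prop : is_CI CI_fun
}.

(* The supremum is taken in the extended reals so that no convention on
   unbounded sets intervenes; for f and g in C(I) it is finite. *)
Definition dCI (R : realType) (f g : R -> R) : \bar R :=
  ereal_sup [set (dh (f x) (g x))%:E | x in O01 R].

Definition homeo_I (R : realType) (f : R -> R) : Prop :=
  [/\ set_bij (I01 R) (I01 R) f,
      {within I01 R, continuous f} &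
      exists2 g : R -> R, {within I01 R, continuous g} &
        forall x, I01 R x -> g (f x) = x].

Record RDS (R : realType) := MkRDS {
  rds0 : CI R;
  rds1 : CI R;
  rdsp : R;
  rds0_homeo : homeo_I rds0;
  rds1_homeo : homeo_I rds1;
  rds0_lt : forall x : R, 0 < x < 1 -> rds0 x < x;
  rds1_gt : forall x : R, 0 < x < 1 -> x < rds1 x;
  rdsp_itv : 0 < rdsp < 1;
  rds_Lambda0 :
    0 < rdsp * ln (derive_at0 rds0) + (1 - rdsp) * ln (derive_at0 rds1);
  rds_Lambda1 :
    0 < rdsp * ln (derive_at1 rds0) + (1 - rdsp) * ln (derive_at1 rds1)
}.

Definition dm (R : realType) (f g : RDS R) : \bar R :=
  maxe (maxe (dCI (rds0 f) (rds0 g)) (dCI (rds1 f) (rds1 g)))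
       `|rdsp f - rdsp g|%:E.

(* [RDS R] is given the topology whose balls are those of [dm].  It is only a
   pseudometric here, because of the values of the maps outside I. *)
Definition rds_ball (R : realType) (f : RDS R) (e : R) : set (RDS R) :=
  [set g | (dm f g < e%:E)%E].

Lemma dCI_refl (R : realType) (f : R -> R) : dCI f f = 0%E.
Proof.
rewrite /dCI; apply/eqP; rewrite eq_le; apply/andP; split.
  by apply: ge_ereal_sup => _ [x _ <-]; rewrite /dh subrr normr0.
apply: ereal_sup_ubound; exists 2^-1.
  by rewrite /O01 /= in_itv /= invr_gt0 ltr0n invf_lt1 ?ltr1n ?ltr0n.
by rewrite /dh subrr normr0.
Qed.

Lemma dCI_sym (R : realType) (f g : R -> R) : dCI f g = dCI g f.
Proof.
by rewrite /dCI; congr ereal_sup; apply/seteqP; split => _ [x x01 <-];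
  exists x => //; rewrite /dh distrC.
Qed.

Lemma dCI_triangle (R : realType) (f g k : R -> R) (a b : R) :
  (dCI f g < a%:E)%E -> (dCI g k < b%:E)%E -> (dCI f k < (a + b)%:E)%E.
Proof.
move=> fg gk; rewrite EFinD.
apply: (@le_lt_trans _ _ (dCI f g + dCI g k)%E); last exact: lteD.
apply: ge_ereal_sup => _ [x x01 <-].
apply: (@le_trans _ _ ((dh (f x) (g x))%:E + (dh (g x) (k x))%:E)%E).
  by rewrite -EFinD lee_fin /dh ler_distD.
by apply: leeD; apply: ereal_sup_ubound; exists x.
Qed.

Lemma rds_ball_center (R : realType) (f : RDS R) (e : R) :
  0 < e -> rds_ball f e f.
Proof.
by move=> e0; rewrite /rds_ball /dm /= !dCI_refl subrr normr0 !maxxx lte_fin.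
Qed.

Lemma rds_ball_sym (R : realType) (f g : RDS R) (e : R) :
  rds_ball f e g -> rds_ball g e f.
Proof.
by rewrite /rds_ball /dm /= (dCI_sym (rds0 f)) (dCI_sym (rds1 f)) distrC.
Qed.

Lemma rds_ball_triangle (R : realType) (f g k : RDS R) (a b : R) :
  rds_ball f a g -> rds_ball g b k -> rds_ball f (a + b) k.
Proof.
rewrite /rds_ball /dm /= !gt_max => /andP[/andP[fg0 fg1] fgp].
move=> /andP[/andP[gk0 gk1] gkp].
rewrite (dCI_triangle fg0 gk0) (dCI_triangle fg1 gk1) /=.
move: fgp gkp; rewrite !lte_fin => fgp gkp.
by rewrite (le_lt_trans (ler_distD (rdsp g) _ _)) // ltrD.
Qed.

HB.instance Definition _ (R : realType) := gen_eqMixin (RDS R).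
HB.instance Definition _ (R : realType) := gen_choiceMixin (RDS R).
HB.instance Definition _ (R : realType) :=
  hasNbhs.Build (RDS R) (nbhs_ (entourage_ (@rds_ball R))).
HB.instance Definition _ (R : realType) :=
  @Nbhs_isPseudoMetric.Build R (RDS R) (entourage_ (@rds_ball R)) erefl
    (@rds_ball R) (@rds_ball_center R) (@rds_ball_sym R)
    (@rds_ball_triangle R) erefl.

(* Borel probability measures on (0, 1) are the Borel probability measures on R
   giving mass 1 to (0, 1). *)
Definition stationary (R : realType) (f : RDS R)
    (mu : probability (measurableTypeR R) R) : Prop :=
  mu (O01 R) = 1%E /\
  forall A : set (measurableTypeR R), measurable A -> A `<=` O01 R ->
    mu A = ((rdsp f)%:E * mu (O01 R `&` rds0 f @^-1` A) +
            (1 - rdsp f)%:E * mu (O01 R `&` rds1 f @^-1` A))%E.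

(* Uniqueness is agreement on Borel sets: in the library a measure is a function
   on all subsets, with unconstrained values on the non-measurable ones. *)
Definition unique_stationary (R : realType) (f : RDS R)
    (mu : probability (measurableTypeR R) R) : Prop :=
  stationary f mu /\
  forall nu : probability (measurableTypeR R) R, stationary f nu ->
    forall A : set (measurableTypeR R), measurable A -> nu A = mu A.

Definition full_support (R : realType)
    (mu : probability (measurableTypeR R) R) : Prop :=
  forall U : set R, open U -> U `<=` O01 R -> U !=set0 -> (0 < mu U)%E.

(* Main.v *)
From HB Require Import structures.
Require Import Defs.
From mathcomp Require Import all_boot all_order all_algebra.
From mathcomp Require Import all_classical all_reals all_analysis.
From mathcomp Require Import measurable_realfun ring lra.

(* Every system in RDS(I) has a unique stationary measure, found through its
   distribution function F, which must satisfy
     F x = p F (f_0^-1 x) + (1 - p) F (f_1^-1 x),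
   that is, F = transfer F.  As Lambda_0 > 0, for small a > 0 the function
   min(1, C x^a) is a supersolution near 0; reflecting at 1/2 gives, from
   Lambda_1 > 0, a subsolution tending to 1 at 1, and iterating the monotone
   operator [transfer] from the supersolution decreases to a solution in between.
   Uniqueness is a maximum principle for the difference of two solutions, which
   vanishes at the ends of (0, 1).

   For density, f_0 and f_1 are made linear near 0, with slopes e^l0 < 1 < e^l1
   such that l1 / l0 is irrational.  By Kronecker's argument the words
   f_1^N f_0^M then send any point of (0, 1) into any given nonempty open set U,
   so a stationary measure not charging U would vanish on (0, 1). *)

Set Implicit Arguments.
Unset Strict Implicit.
Unset Printing Implicit Defensive.

Import Order.TTheory GRing.Theory Num.Theory.
Import numFieldNormedType.Exports.

Local Open Scope classical_set_scope.
Local Open Scope ring_scope.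

(** * Increasing bijections and the transfer operator *)

Section IncreasingBijections.
Context {R : realType}.
Implicit Types (F K G : R -> R) (x y e d : R).

(** The maps of I are handled as bijections of the whole line, so that an inequality can be moved
    from [G] to [K] without any domain condition. *)
Definition increasing_bij G K :=
  [/\ {mono G : x y / x <= y}, cancel G K & cancel K G].

Lemma increasing_bij_sym G K : increasing_bij G K -> increasing_bij K G.
Proof. by move=> [mG GK KG]; split=> // x y; rewrite -mG !KG. Qed.

Lemma increasing_bij_lt G K : increasing_bij G K -> {mono G : x y / x < y}.
Proof. by move=> [mG _ _]; exact: leW_mono. Qed.

Lemma increasing_bij_swap_le G K x y :
  increasing_bij G K -> (G x <= y) = (x <= K y).
Proof. by move=> [mG _ KG]; rewrite -{1}(KG y) mG. Qed.

Lemma increasing_bij_swap_lt G K x y :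
  increasing_bij G K -> (G x < y) = (x < K y).
Proof.
by move=> GK; have [_ _ KG] := GK; rewrite -{1}(KG y) (increasing_bij_lt GK).
Qed.

Lemma increasing_bij_reflect G K : increasing_bij G K ->
  increasing_bij (fun x => 1 - G (1 - x)) (fun x => 1 - K (1 - x)).
Proof.
move=> [mG GK KG]; split=> [x y|x|x].
- by rewrite lerD2l lerN2 mG lerD2l lerN2.
- by rewrite subKr GK subKr.
- by rewrite subKr KG subKr.
Qed.

Lemma iter_increasing_bij G K n : increasing_bij G K ->
  increasing_bij (iter n G) (iter n K).
Proof.
move=> [mG GK KG]; split.
- by elim: n => //= n ih x y; rewrite mG ih.
- by elim: n => // n ih x; rewrite iterSr iterS GK ih.
- by elim: n => // n ih x; rewrite iterSr iterS KG ih.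
Qed.

(** Let L be the infimum of the orbit. If L were positive, then L < [G] L, so some iterate would lie
    below [G] L and the next one below L. *)
Lemma iter_lt_near0 G K x e : increasing_bij G K ->
  (forall y, 0 < y < 1 -> 0 < K y < y) -> 0 < x < 1 -> 0 < e ->
  exists n, 0 < iter n K x < e.
Proof.
move=> GK Klt x01 e0.
have it01 n : 0 < iter n K x < 1.
  elim: n => //= n /[dup] /andP[_ lt1] /Klt/andP[-> h].
  exact: lt_trans h lt1.
pose A := [set iter n K x | n in [set: nat]].
have A0 : has_inf A.
  split; first by exists x; exists 0%N.
  by exists 0 => _ [n _ <-]; case/andP: (it01 n) => /ltW.
have [L0|L0] := leP (inf A) 0.
  have : inf A < inf A + e by rewrite ltrDl.
  move=> /(inf_lt (proj1 A0))[_ [n _ <-] h]; exists n; case/andP: (it01 n) => -> _ /=.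
  by apply: (lt_le_trans h); rewrite gerDr.
have L1 : inf A < 1.
  apply: (@le_lt_trans _ _ x); last by case/andP: x01.
  by apply: ge_inf; [case: A0 | exists 0%N].
have : inf A < G (inf A).
  rewrite -(increasing_bij_swap_lt _ _ (increasing_bij_sym GK)).
  by have /Klt/andP[] : 0 < inf A < 1 by rewrite L0.
move=> /(inf_lt (proj1 A0))[_ [n _ <-]].
rewrite -(increasing_bij_swap_lt _ _ (increasing_bij_sym GK)) => h.
have : inf A <= K (iter n K x) by apply: ge_inf; [case: A0 | exists n.+1].
by rewrite leNgt h.
Qed.

(* For nondecreasing [F] this is right-continuity, in a form that is inherited
   by infima. *)
Definition usc_right F :=
  forall x e, 0 < e -> exists2 d, 0 < d & F (x + d) < F x + e.

Lemma usc_right_comp F G K :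
  increasing_bij G K -> usc_right F -> usc_right (F \o K).
Proof.
move=> GK uF x e /(uF (K x))[d d0 h]; exists (G (K x + d) - x).
  have [_ _ KG] := GK.
  by rewrite subr_gt0 -{1}(KG x) (increasing_bij_lt GK) ltrDl.
by have [_ GK' _] := GK; rewrite /= addrC subrK GK'.
Qed.

Lemma nondecreasing_usc_right_continuous F :
  {homo F : x y / x <= y} -> usc_right F ->
  forall x, F y @[y --> x^'+] --> F x.
Proof.
move=> mF uF x; apply/cvgrPdist_lt => e e0.
have [d d0 h] := uF x _ e0.
near=> y.
have xy : x <= y by apply/ltW; near: y; exact: nbhs_right_gt.
rewrite distrC ger0_norm ?subr_ge0 ?mF// ltrBlDl.
apply: le_lt_trans h; apply: mF.
by near: y; apply: nbhs_right_le; rewrite ltrDl.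
Unshelve. all: by end_near. Qed.

End IncreasingBijections.

(** * Monotone iteration of the transfer operator and a maximum principle *)

Section TransferOperator.
Context {R : realType} (p : R) (K0 K1 G0 G1 : R -> R).
Hypothesis p01 : 0 < p < 1.
Hypothesis GK0 : increasing_bij G0 K0.
Hypothesis GK1 : increasing_bij G1 K1.
Implicit Types (F Phi Psi : R -> R) (x e : R).

Definition transfer F x := p * F (K0 x) + (1 - p) * F (K1 x).

Let p0 : 0 < p. Proof. by case/andP: p01. Qed.
Let q0 : 0 < 1 - p. Proof. by rewrite subr_gt0; case/andP: p01. Qed.

Lemma transfer_le F F' : (forall x, F x <= F' x) ->
  forall x, transfer F x <= transfer F' x.
Proof. by move=> h x; apply: lerD; rewrite ler_pM2l. Qed.

Lemma transfer_homo F :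
  {homo F : x y / x <= y} -> {homo transfer F : x y / x <= y}.
Proof.
move=> mF x y xy; have [mK0 _ _] := increasing_bij_sym GK0.
have [mK1 _ _] := increasing_bij_sym GK1.
by apply: lerD; rewrite ler_pM2l ?mF ?mK0 ?mK1.
Qed.

Lemma usc_right_transfer F :
  {homo F : x y / x <= y} -> usc_right F -> usc_right (transfer F).
Proof.
move=> mF uF x e e0.
have [d0 d00 h0] := usc_right_comp GK0 uF x e0.
have [d1 d10 h1] := usc_right_comp GK1 uF x e0.
have [mK0 _ _] := increasing_bij_sym GK0.
have [mK1 _ _] := increasing_bij_sym GK1.
exists (Num.min d0 d1); first by rewrite lt_min d00.
rewrite /transfer.
have -> : p * F (K0 x) + (1 - p) * F (K1 x) + e =
  p * (F (K0 x) + e) + (1 - p) * (F (K1 x) + e) by ring.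
apply: ltrD; rewrite ltr_pM2l//.
  apply: le_lt_trans h0; apply: mF; rewrite mK0 lerD2l.
  by rewrite ge_min lexx.
apply: le_lt_trans h1; apply: mF; rewrite mK1 lerD2l.
by rewrite ge_min lexx orbT.
Qed.

(** The iterates of [Phi] decrease and stay above [Psi], so they converge pointwise; [transfer]
    combines finitely many values linearly, hence commutes with the limit. *)
Lemma transfer_fixpoint Phi Psi :
  {homo Phi : x y / x <= y} -> usc_right Phi ->
  (forall x, transfer Phi x <= Phi x) -> (forall x, Psi x <= transfer Psi x) ->
  (forall x, Psi x <= Phi x) ->
  exists F, [/\ {homo F : x y / x <= y}, usc_right F,
    forall x, transfer F x = F x & forall x, Psi x <= F x <= Phi x].
Proof.
move=> mPhi uPhi supPhi subPsi PsiPhi.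
pose u n := iter n transfer Phi.
have mu n : {homo u n : x y / x <= y} by elim: n => //= n; exact: transfer_homo.
have uu n : usc_right (u n).
  by elim: n => //= n h; apply: usc_right_transfer => //; exact: mu.
have Psiu n x : Psi x <= u n x.
  elim: n x => //= n h x; apply: (le_trans (subPsi x)); exact: transfer_le.
have uS n x : u n.+1 x <= u n x.
  elim: n x => [|n h] x; first exact: supPhi.
  exact: (transfer_le h).
have ni x : nonincreasing_seq (u ^~ x) by apply/nonincreasing_seqP => n; exact: uS.
have cu x : cvgn (u ^~ x).
  apply: nonincreasing_is_cvgn => //; exists (Psi x) => _ [n _ <-]; exact: Psiu.
pose F x := limn (u ^~ x).
have Fu n x : F x <= u n x by exact: nonincreasing_cvgn_ge.
exists F; split.
- move=> x y xy; apply: ler_lim => //; by near=> n; exact: mu.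
(* Right-continuity passes to the infimum: take [n] with [u n x] within [e / 2] of the limit and the
   [d] of that single iterate, and use [F <= u n] at [x + d]. *)
- move=> x e e0.
  have : \forall n \near \oo, u n x < F x + e / 2.
    by apply: (cvgr_lt (F x)); [exact: cu | rewrite ltrDl divr_gt0].
  move=> [n _ /(_ n (leqnn n))/= h].
  have [d d0 hd] := uu n x (e / 2) ltac:(by rewrite divr_gt0).
  exists d => //; apply: (le_lt_trans (Fu n _)); lra.
- move=> x; apply/esym.
  have c1 : u n.+1 x @[n --> \oo] --> transfer F x.
    by apply: cvgD; apply: cvgMl_tmp; exact: cu.
  apply: cvg_lim => //; by rewrite -(cvg_shiftS (u ^~ x)).
- move=> x; rewrite (Fu 0%N x) andbT.
  by apply: limr_ge => //; near=> n; exact: Psiu.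
Unshelve. all: by end_near. Qed.

(** If an average of two values bounded by [M] is within [c] of [M], the value of weight [1 - p] is
    within [c / (1 - p)] of [M]. Each application of [K1] costs one such factor. *)
Lemma transfer_iter_lower F M d x n : 0 <= d -> (forall y, F y <= M) ->
  (forall y, transfer F y = F y) -> M - d <= F x ->
  M - d / (1 - p) ^+ n <= F (iter n K1 x).
Proof.
move=> d0 FM harm h; elim: n => [|n ih /=]; first by rewrite expr0 divr1.
rewrite exprSr invfM mulrA; set c := d / _ in ih *.
set y := iter n K1 x in ih *.
have := harm y; rewrite /transfer => E.
have : F y <= p * M + (1 - p) * F (K1 y) by rewrite -E lerD2r ler_pM2l.
move=> E2; have : (M - F (K1 y)) * (1 - p) <= c by lra.
by rewrite -ler_pdivlMr//; lra.
Qed.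

Hypothesis K1lt : forall y, 0 < y < 1 -> 0 < K1 y < y.

(* A maximum principle: a value of [F] close to the supremum [M] propagates
   along the orbit of [K1], hence to points near 0, where [F] is small. *)
Lemma transfer_max_principle F : (exists M, forall x, F x <= M) ->
  (forall x, transfer F x = F x) ->
  (forall e, 0 < e -> exists2 d, 0 < d & forall x, x < d -> F x < e) ->
  (forall e, 0 < e -> exists2 d, 0 < d & forall x, 1 - d < x -> F x < e) ->
  forall x, F x <= 0.
Proof.
move=> [B FB] harm near0 near1 x; rewrite leNgt; apply/negP => Fx0.
pose A := range F.
have A0 : has_sup A by split; [exists (F x); exists x | exists B => _ [y _ <-]].
pose M := sup A.
have FM y : F y <= M by apply: ub_le_sup; [case: A0 | exists y].
have M0 : 0 < M by apply: lt_le_trans Fx0 _.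
have M20 : 0 < M / 2 by rewrite divr_gt0.
have [d d0 hd] := near0 _ M20.
have [d' d'0 hd'] := near1 _ M20.
(* Beyond [r] the values are below [M / 2], so near-maximal points lie below [r]. The [1 / 2] keeps
   [r] positive. Since [r] does not depend on the point, [n] can be fixed before it. *)
pose r := 1 - Num.min d' (1 / 2).
have r01 : 0 < r < 1.
  rewrite /r; have [|] := leP d' (1/2); lra.
have [n /andP[_ hn]] := iter_lt_near0 GK1 K1lt r01 d0.
have qn : 0 < (1 - p) ^+ n by rewrite exprn_gt0.
(* This defect grows to exactly [M / 2] after [n] steps of [K1]. *)
pose e := M / 2 * (1 - p) ^+ n.
have e0 : 0 < e by rewrite mulr_gt0.
have qn1 : (1 - p) ^+ n <= 1.
  by rewrite exprn_ile1 ?ltW//; case/andP: p01 => *; lra.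
have eM : e <= M / 2 by rewrite ger_pMr.
have := @sup_adherent _ A e e0 A0; rewrite -/M => -[_ [y _ <-] My].
have yr : y <= r.
  rewrite leNgt; apply/negP => ry.
  suff : F y < M / 2 by lra.
  apply: hd'; apply: le_lt_trans ry; rewrite /r lerD2l lerN2.
  by rewrite ge_min lexx.
have := transfer_iter_lower n (ltW e0) FM harm (ltW My).
rewrite /e mulfK ?gt_eqF// => h.
suff : F (iter n K1 y) < M / 2 by lra.
apply: hd; apply: le_lt_trans hn.
have [mK1 _ _] := increasing_bij_sym GK1.
by elim: n {qn e e0 qn1 eM My h} => //= n; rewrite mK1.
Qed.

End TransferOperator.

(** * Supersolutions at an endpoint *)

Section Supersolution.
Context {R : realType}.
Implicit Types (p a l t x : R).

Lemma expRN_le t : `|t| <= 1 / 2 -> expR (- t) <= 1 - t + 2 * t ^+ 2.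
Proof.
rewrite ler_norml => /andP[t1 t2].
have t0 : 0 < 1 + t by lra.
have h := expR_ge1Dx t.
(* The remaining inequality is (1 + t)(1 - t + 2t^2) = 1 + t^2 (1 + 2t) >= 1. *)
rewrite expRN; apply: (@le_trans _ _ (1 + t)^-1).
  by rewrite lef_pV2 ?posrE ?expR_gt0.
rewrite -[leLHS]mul1r ler_pdivrMr//.
have : 0 <= t ^+ 2 * (1 + 2 * t) by rewrite mulr_ge0 ?sqr_ge0//; lra.
lra.
Qed.

(** As a function of [a], the left-hand side equals 1 at 0 and has derivative -L < 0 there, L being
    the mean of [l0] and [l1]; the bound [expRN_le] makes this quantitative. *)
Lemma mean_expRN_le1 p l0 l1 : 0 < p < 1 -> 0 < p * l0 + (1 - p) * l1 ->
  exists2 a, 0 < a & p * expR (- (a * l0)) + (1 - p) * expR (- (a * l1)) <= 1.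
Proof.
move=> /andP[p0 p1] L0; set L := _ + _ in L0.
pose B := 1 + `|l0| + `|l1|.
have B0 : 0 < B by rewrite /B; have := normr_ge0 l0; have := normr_ge0 l1; lra.
pose S := 1 + 2 * (p * l0 ^+ 2 + (1 - p) * l1 ^+ 2).
have S0 : 0 < S.
  have : 0 <= p * l0 ^+ 2 by rewrite mulr_ge0 ?sqr_ge0 ?ltW.
  have : 0 <= (1 - p) * l1 ^+ 2 by rewrite mulr_ge0 ?sqr_ge0//; lra.
  by rewrite /S; lra.
(* The first bound puts both exponents in the range of [expRN_le]; the second lets the linear gain
   [a * L] absorb the quadratic terms, which are at most [a ^+ 2 * S]. *)
pose a := Num.min (1 / (2 * B)) (L / S).
have a0 : 0 < a by rewrite lt_min !divr_gt0// mulr_gt0.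
have aB : a * B <= 1 / 2.
  have : a <= 1 / (2 * B) by rewrite ge_min lexx.
  by rewrite ler_pdivlMr ?mulr_gt0//; lra.
have aS : a * S <= L.
  have : a <= L / S by rewrite ge_min lexx orbT.
  by rewrite ler_pdivlMr.
have bd l : `|l| <= B -> expR (- (a * l)) <= 1 - a * l + 2 * (a * l) ^+ 2.
  move=> lB; apply: expRN_le; rewrite normrM (gtr0_norm a0).
  by apply: le_trans aB; rewrite ler_pM2l.
have h0 := bd l0 ltac:(rewrite /B; have := normr_ge0 l1; lra).
have h1 := bd l1 ltac:(rewrite /B; have := normr_ge0 l0; lra).
exists a => //.
have h2 : p * expR (- (a * l0)) <= p * (1 - a * l0 + 2 * (a * l0) ^+ 2).
  by rewrite ler_pM2l.
have h3 : (1 - p) * expR (- (a * l1)) <= (1 - p) * (1 - a * l1 + 2 * (a * l1) ^+ 2).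
  by rewrite ler_pM2l ?subr_gt0.
have : a * (a * S) <= a * L by rewrite ler_pM2l.
have : 0 <= a ^+ 2 by rewrite sqr_ge0.
rewrite /S /L; lra.
Qed.

(** The function min(1, (x / e^h)^a), extended by 0 to the negative half-line; the power is written
    through [expR] and [ln]. *)
Definition power_cap (a h x : R) : R :=
  if x <= 0 then 0 else Num.min 1 (expR (a * (ln x - h))).

Lemma power_cap_gt0E a h x :
  0 < x -> power_cap a h x = Num.min 1 (expR (a * (ln x - h))).
Proof. by move=> x0; rewrite /power_cap leNgt x0. Qed.

Lemma power_cap_ge0 a h x : 0 <= power_cap a h x.
Proof.
by rewrite /power_cap; case: ifP => // _; rewrite le_min ler01 expR_ge0.
Qed.

Lemma power_cap_le1 a h x : power_cap a h x <= 1.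
Proof. by rewrite /power_cap; case: ifP => // _; rewrite ge_min lexx. Qed.

Lemma power_cap_le a h x : 0 < x -> power_cap a h x <= expR (a * (ln x - h)).
Proof.
by move=> x0; rewrite power_cap_gt0E// ge_min lexx orbT.
Qed.

Lemma power_cap_eq1 a h x : 0 < a -> expR h <= x -> power_cap a h x = 1.
Proof.
move=> a0 hx; have x0 : 0 < x by apply: lt_le_trans hx; exact: expR_gt0.
rewrite power_cap_gt0E//; apply/min_idPl.
rewrite -[leLHS]expR0 ler_expR pmulr_rge0// subr_ge0.
by rewrite -(expRK h) ler_ln ?posrE ?expR_gt0.
Qed.

Lemma power_cap_homo a h : 0 < a -> {homo power_cap a h : x y / x <= y}.
Proof.
move=> a0 x y xy; rewrite {1}/power_cap; have [|x0] := leP x 0.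
  by move=> _; exact: power_cap_ge0.
have y0 : 0 < y by exact: lt_le_trans xy.
rewrite power_cap_gt0E// le_min !ge_min lexx /=.
apply/orP; right; rewrite ler_expR ler_pM2l// lerD2r.
by rewrite ler_ln ?posrE.
Qed.

Lemma power_cap_usc a h : 0 < a -> usc_right (power_cap a h).
Proof.
move=> a0 x e e0; have [x0|x0|->] := ltgtP x 0.
- exists (- x); first by rewrite oppr_gt0.
  by rewrite subrr {1}/power_cap lexx; have := power_cap_ge0 a h x; lra.
(* Multiplying [x] by [expR t] multiplies the power by [1 + e / 2], which raises the capped value by
   less than [e]. *)
- pose t := ln (1 + e / 2) / a.
  have t0 : 0 < t by rewrite divr_gt0 ?ln_gt0//; lra.
  exists (x * (expR t - 1)).
    by rewrite mulr_gt0// subr_gt0 -expR0 ltr_expR.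
  have -> : x + x * (expR t - 1) = x * expR t by ring.
  have u0 : 0 < 1 + e / 2 by lra.
  rewrite !power_cap_gt0E ?mulr_gt0 ?expR_gt0//.
  rewrite lnM ?posrE ?expR_gt0// expRK.
  have -> : a * (ln x + t - h) = ln (1 + e / 2) + a * (ln x - h).
    by rewrite /t; field; rewrite gt_eqF.
  rewrite expRD lnK ?posrE//; set A := expR _.
  have A0 : 0 < A by exact: expR_gt0.
  have [A1|A1] := leP 1 A; rewrite gt_min; apply/orP; first by left; lra.
  right; have : A * e < 1 * e by rewrite ltr_pM2r.
  lra.
- exists (expR (h + ln (e / 2) / a)); first exact: expR_gt0.
  rewrite add0r; apply: (le_lt_trans (power_cap_le _ _ (expR_gt0 _))).
  rewrite expRK addrC addKr mulrC divfK ?gt_eqF// lnK ?posrE ?divr_gt0//.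
  have := power_cap_ge0 a h 0; lra.
Qed.

(** Where the cap is active, [Phi] is 1 and nothing can exceed it. Below the cap, applying [K0] or
    [K1] multiplies the bound on the power by e^(-a l0) or e^(-a l1), and [a] is chosen so that the
    mean of these factors is at most 1. *)
Lemma transfer_supersolution p (K0 K1 : R -> R) l0 l1 d : 0 < p < 1 ->
  0 < p * l0 + (1 - p) * l1 -> 0 < d ->
  (forall x, x <= 0 -> K0 x <= 0) -> (forall x, x <= 0 -> K1 x <= 0) ->
  (forall x, 0 < x < d -> K0 x <= expR (- l0) * x) ->
  (forall x, 0 < x < d -> K1 x <= expR (- l1) * x) ->
  exists Phi : R -> R, [/\ {homo Phi : x y / x <= y}, usc_right Phi,
    forall x, transfer p K0 K1 Phi x <= Phi x &
    [/\ forall x, x <= 0 -> Phi x = 0, forall x, 1 / 2 <= x -> Phi x = 1 &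
        forall x, 0 <= Phi x <= 1]].
Proof.
move=> p01 L0 d0 K00 K10 K0d K1d.
have [a a0 ha] := mean_expRN_le1 p01 L0.
have /andP[p0 p1] := p01.
(* The cap is reached at [n]: before [d], so that the linear bounds hold wherever they are used, and
   before [1 / 2], which later orders the sub- and supersolution. *)
pose n := Num.min d (1 / 2).
have n0 : 0 < n by rewrite lt_min d0; lra.
pose h := ln n; pose Phi := power_cap a h.
have hn : expR h = n by rewrite lnK ?posrE.
have mPhi : {homo Phi : x y / x <= y} by exact: power_cap_homo.
have Phi0 x : x <= 0 -> Phi x = 0 by rewrite /Phi /power_cap => ->.
exists Phi; split => //.
- exact: power_cap_usc.
- move=> x; have [x0|x0] := leP x 0.
    by rewrite /transfer !Phi0 ?K00 ?K10// !mulr0 addr0.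
  have [nx|xn] := leP n x.
    rewrite [leRHS]power_cap_eq1 ?hn//.
    have := power_cap_le1 a h (K0 x); have := power_cap_le1 a h (K1 x).
    rewrite -!/(Phi _) => h1 h2.
    have : p * Phi (K0 x) <= p * 1 by rewrite ler_pM2l.
    have : (1 - p) * Phi (K1 x) <= (1 - p) * 1 by rewrite ler_pM2l// subr_gt0.
    rewrite /transfer; lra.
  have xd : 0 < x < d by rewrite x0 /= (lt_le_trans xn)// ge_min lexx.
  have bd K l : K x <= expR (- l) * x ->
      Phi (K x) <= expR (- (a * l)) * expR (a * (ln x - h)).
    move=> /mPhi/le_trans; apply; apply: (le_trans (power_cap_le _ _ _)).
      by rewrite mulr_gt0 ?expR_gt0.
    by rewrite lnM ?posrE ?expR_gt0// expRK -expRD ler_expR; lra.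
  have -> : Phi x = expR (a * (ln x - h)).
    rewrite /Phi power_cap_gt0E//; apply/min_idPr.
    rewrite -[leRHS]expR0 ler_expR pmulr_rle0// subr_le0 ler_ln ?posrE//.
    exact: ltW.
  have := bd K0 l0 (K0d _ xd); have := bd K1 l1 (K1d _ xd).
  set E := expR (a * (ln x - h)) => h1 h2.
  have E0 : 0 < E by exact: expR_gt0.
  have : p * Phi (K0 x) <= p * (expR (- (a * l0)) * E) by rewrite ler_pM2l.
  have : (1 - p) * Phi (K1 x) <= (1 - p) * (expR (- (a * l1)) * E).
    by rewrite ler_pM2l// subr_gt0.
  have : E * (p * expR (- (a * l0)) + (1 - p) * expR (- (a * l1))) <= E * 1.
    by rewrite ler_pM2l.
  rewrite /transfer; lra.
split => // x; last by rewrite power_cap_ge0 power_cap_le1.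
- move=> hx; apply: power_cap_eq1 => //; rewrite hn.
  by apply: le_trans hx; rewrite ge_min lexx orbT.
Qed.

End Supersolution.

(** * Measures on the line and distribution functions *)

Section CdfMeasures.
Context {R : realType}.
Local Notation T := (measurableTypeR R).
Local Open Scope ereal_scope.

(** The half-open intervals form a generating pi-system. Arbitrary measures are allowed because one
    side will be a weighted sum of image measures. *)
Lemma measure_eq_cdf (m1 m2 : measure T R) :
  (forall x : R, m1 `]-oo, x]%classic = m2 `]-oo, x]%classic) ->
  (forall x : R, m1 `]-oo, x]%classic < +oo) ->
  forall A, measurable A -> m1 A = m2 A.
Proof.
move=> m12 fin1.
have fin2 x : m2 `]-oo, x]%classic < +oo by rewrite -m12.
have oc (a b : R) : m1 `]a, b]%classic = m2 `]a, b]%classic.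
  have [ab|ba] := leP a b; last first.
    by rewrite set_itv_ge ?measure0// bnd_simp -leNgt ltW.
  have -> : `]a, b]%classic = `]-oo, b] `\` `]-oo, a] :> set T.
    by rewrite -[RHS]setCK setCD setCitvl setUC -[LHS]setCK setCitv.
  by rewrite !measureD ?m12//= !setIidr ?m12//; exact: subset_itvl.
apply: (@measure_unique _ R T (@ocitv R) (fun n => `](- n%:R)%R, n%:R]%classic)
  erefl (@ocitvI R)).
- by move=> n; exact: is_ocitv.
- by rewrite (bigcup_itvT false false).
- by move=> _ [[a b] _ <-]; exact: oc.
- move=> k; apply: le_lt_trans (fin1 k%:R); apply: le_measure; rewrite ?inE//.
  exact: subset_itvr.
Qed.

Lemma probability_of_cdf (F : R -> R) :
  {homo F : x y / (x <= y)%R} -> usc_right F ->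
  (forall x, (x <= 0)%R -> F x = 0%R) -> (forall x, (1 <= x)%R -> F x = 1%R) ->
  exists mu : probability T R, forall x, mu `]-oo, x]%classic = (F x)%:E.
Proof.
move=> mF uF F0 F1.
have rF := nondecreasing_usc_right_continuous mF uF.
have FNy : F x @[x --> -oo%R] --> (0 : R)%R.
  apply: cvg_near_cst; near=> x; apply: F0; near: x.
  exact: nbhs_ninfty_le.
have Fy : F x @[x --> +oo%R] --> (1 : R)%R.
  apply: cvg_near_cst; near=> x; apply: F1; near: x.
  exact: nbhs_pinfty_ge.
pose c1 := isCumulative.Build R _ R F mF rF.
pose c2 := isCumulativeBounded.Build R 0%R 1%R F FNy Fy.
pose f : cumulativeBounded (0:R)%R (1:R)%R := HB.pack F c1 c2.
exists (lebesgue_stieltjes_measure f) => x.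
by rewrite -(cdf_lebesgue_stieltjes_id f).
Unshelve. all: by end_near. Qed.

End CdfMeasures.

(** * Maps in C(I) and their inverses *)

Section Extension.
Context {R : realType}.
Implicit Types (f G K : R -> R) (x y c d : R).

(** Continuing a homeomorphism of I by the identity gives a bijection of the line that does not see
    the arbitrary values of [f] outside I. *)
Definition extension f G K :=
  [/\ increasing_bij G K, forall x, 0 <= x <= 1 -> G x = f x &
      forall x, ~~ (0 < x < 1) -> G x = x].

Lemma CI_homo (f : CI R) : homeo_I f -> {in `[0, 1] &, {mono f : x y / x <= y}}.
Proof.
move=> [[_ injf _] cf _].
apply: segment_continuous_inj_le => //.
- by rewrite (CI_0 (CI_prop f)) (CI_1 (CI_prop f)).
- move=> x y x01 y01; apply: injf; rewrite inE; first by move: x01.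
  by move: y01.
Qed.

Lemma CI_extension (f : CI R) : homeo_I f -> exists G K, extension f G K.
Proof.
move=> hf; have mf := CI_homo hf.
have [[imf injf surf] cf [g cg gK]] := hf.
pose I01b x := 0 <= x <= 1.
have f01 x : I01b x -> I01b (f x).
  move=> x01; have : I01 R (f x) by apply: imf; rewrite /I01/= in_itv.
  by rewrite /I01/= in_itv.
have gK' x : I01b x -> g (f x) = x.
  by move=> x01; apply: gK; rewrite /I01/= in_itv.
have Kg x : I01b x -> I01b (g x) /\ f (g x) = x.
  move=> x01; have : I01 R x by rewrite /I01/= in_itv.
  move=> /surf[y]; rewrite /I01/= in_itv/= => y01 <-.
  by rewrite gK'.
pose ext (h : R -> R) x := if I01b x then h x else x.
exists (ext f), (ext g); split.
- split.
  + have aux x y : I01b x -> ~~ I01b y ->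
        (f x <= y) = (x <= y) /\ (y <= f x) = (y <= x).
      move=> /[dup] /f01 /andP[fx0 fx1] /andP[x0 x1]; rewrite negb_and -!ltNge.
      case/orP => hy.
        split; first by rewrite !leNgt (lt_le_trans hy) ?(lt_le_trans hy).
        by rewrite !(ltW (lt_le_trans hy _)).
      split; first by rewrite !(ltW (le_lt_trans _ hy)).
      by rewrite !leNgt (le_lt_trans _ hy) ?(le_lt_trans _ hy).
    move=> x y; rewrite /ext; case: ifPn => hx; case: ifPn => hy //.
    * by apply: mf; rewrite in_itv.
    * by case: (aux x y).
    * by case: (aux y x).
  + move=> x; rewrite {2}/ext; case: ifPn => hx; rewrite /ext.
      by rewrite f01 ?gK'.
    by rewrite (negbTE hx).
  + move=> x; rewrite {2}/ext; case: ifPn => hx; rewrite /ext.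
      by have [-> ->] := Kg _ hx.
    by rewrite (negbTE hx).
- by move=> x hx; rewrite /ext /I01b hx.
- move=> x; rewrite negb_and -!leNgt /ext => hx; case: ifP => // /andP[x0 x1].
  case/orP: hx => hx.
    have -> : x = 0 by apply/eqP; rewrite eq_le hx.
    exact: CI_0 (CI_prop f).
  have -> : x = 1 by apply/eqP; rewrite eq_le hx x1.
  exact: CI_1 (CI_prop f).
Qed.

Section ExtensionTheory.
Variables (f G K : R -> R).
Hypothesis ext : extension f G K.

Lemma extension_inv_out x : ~~ (0 < x < 1) -> K x = x.
Proof.
by have [[_ GK _] _ Gout] := ext; move=> /Gout {1}<-; rewrite GK.
Qed.

Lemma extension_out01 : [/\ G 0 = 0, G 1 = 1, K 0 = 0 & K 1 = 1].
Proof.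
have [_ _ Gout] := ext.
have h0 : ~~ ((0 : R) < 0 < (1 : R)) by rewrite ltxx.
have h1 : ~~ ((0 : R) < 1 < (1 : R)) by rewrite ltxx andbF.
by rewrite !Gout// !extension_inv_out.
Qed.

Lemma extension_le0 x : (K x <= 0) = (x <= 0).
Proof.
have [GK _ _] := ext; have [G0 _ _ _] := extension_out01.
by rewrite (increasing_bij_swap_le _ _ (increasing_bij_sym GK)) G0.
Qed.

Lemma extension_lt1 x : (K x < 1) = (x < 1).
Proof.
have [GK _ _] := ext; have [_ G1 _ _] := extension_out01.
by rewrite (increasing_bij_swap_lt _ _ (increasing_bij_sym GK)) G1.
Qed.

Lemma extension_inv01 x : (0 < K x < 1) = (0 < x < 1).
Proof. by rewrite extension_lt1 !ltNge extension_le0. Qed.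

End ExtensionTheory.

Lemma extension_fun01 f G K x : extension f G K -> (0 < G x < 1) = (0 < x < 1).
Proof.
move=> ext; rewrite -(extension_inv01 ext).
by have [[_ -> _] _ _] := ext.
Qed.

Lemma increasing_bij_inv_bound G K c d : increasing_bij G K -> G 0 = 0 ->
  0 < d -> (forall y, 0 < y < d -> expR c * y <= G y) ->
  exists2 d', 0 < d' & forall x, 0 < x < d' -> K x <= expR (- c) * x.
Proof.
move=> GK G0 d0 h; exists (G d).
  by rewrite -G0 (increasing_bij_lt GK).
move=> x /andP[x0 xd].
have y0 : 0 < K x by rewrite -(increasing_bij_swap_lt _ _ GK) G0.
have yd : K x < d by rewrite (increasing_bij_swap_lt _ _ (increasing_bij_sym GK)).
have := h (K x); rewrite y0 yd => /(_ isT).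
have [_ _ ->] := GK; rewrite expRN => hx.
by rewrite mulrC ler_pdivlMr ?expR_gt0// mulrC.
Qed.

Lemma supersolution_of_slopes p G0 K0 G1 K1 l0 l1 :
  increasing_bij G0 K0 -> increasing_bij G1 K1 -> G0 0 = 0 -> G1 0 = 0 ->
  0 < p < 1 -> 0 < p * l0 + (1 - p) * l1 ->
  (forall c, c < l0 ->
    exists2 d, 0 < d & forall y, 0 < y < d -> expR c * y <= G0 y) ->
  (forall c, c < l1 ->
    exists2 d, 0 < d & forall y, 0 < y < d -> expR c * y <= G1 y) ->
  exists Phi : R -> R, [/\ {homo Phi : x y / x <= y}, usc_right Phi,
    forall x, transfer p K0 K1 Phi x <= Phi x &
    [/\ forall x, x <= 0 -> Phi x = 0, forall x, 1 / 2 <= x -> Phi x = 1 &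
        forall x, 0 <= Phi x <= 1]].
Proof.
move=> GK0 GK1 G00 G10 p01; set L := _ + _ => L0.
(* The derivatives only give linear bounds with strictly smaller exponents; lowering both by [L / 2]
   leaves the mean [L / 2], still positive. *)
have lt (l : R) : l - L / 2 < l by lra.
move=> /(_ _ (lt l0))[d d0 /(increasing_bij_inv_bound GK0 G00 d0)[d' d'0 hd']].
move=> /(_ _ (lt l1))[c c0 /(increasing_bij_inv_bound GK1 G10 c0)[c' c'0 hc']].
apply: (@transfer_supersolution _ p K0 K1 (l0 - L / 2) (l1 - L / 2)
  (Num.min d' c')) => //.
- have -> : p * (l0 - L / 2) + (1 - p) * (l1 - L / 2) = L - L / 2.
    by rewrite /L; ring.
  lra.
- by rewrite lt_min d'0.
- by move=> x; rewrite (increasing_bij_swap_le _ _ (increasing_bij_sym GK0)) G00.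
- by move=> x; rewrite (increasing_bij_swap_le _ _ (increasing_bij_sym GK1)) G10.
- by move=> x; rewrite lt_min => /and3P[x0 xd _]; apply: hd'; rewrite x0.
- by move=> x; rewrite lt_min => /and3P[x0 _ xd]; apply: hc'; rewrite x0.
Qed.

Lemma CI_lower_bound0 (f : CI R) G K c : extension f G K -> c < ln (derive_at0 f) ->
  exists2 d, 0 < d & forall y, 0 < y < d -> expR c * y <= G y.
Proof.
move=> [_ Gf _] cs; have P := CI_prop f.
have s0 := CI_derive0_gt0 P.
have es : expR c < derive_at0 f by rewrite -(lnK s0) ltr_expR.
have := @cvgr_gt _ _ _ _ _ _ (CI_derivable0 P) _ es.
move=> [e /= e0 he]; exists (Num.min e 1); first by rewrite lt_min e0 /=.
move=> y /andP[y0]; rewrite lt_min => /andP[ye y1].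
rewrite Gf ?ltW ?y0//.
have := he y; rewrite /= sub0r normrN gtr0_norm// => /(_ ye y0).
rewrite /dquot (CI_0 P) !subr0 ltr_pdivlMr// => /ltW; exact.
Qed.

Lemma CI_lower_bound1 (f : CI R) G K c : extension f G K -> c < ln (derive_at1 f) ->
  exists2 d, 0 < d & forall y, 0 < y < d -> expR c * y <= 1 - G (1 - y).
Proof.
move=> [_ Gf _] cs; have P := CI_prop f.
have s0 := CI_derive1_gt0 P.
have es : expR c < derive_at1 f by rewrite -(lnK s0) ltr_expR.
have := @cvgr_gt _ _ _ _ _ _ (CI_derivable1 P) _ es.
move=> [e /= e0 he]; exists (Num.min e 1); first by rewrite lt_min e0 /=.
move=> y /andP[y0]; rewrite lt_min => /andP[ye y1].
rewrite Gf; last by apply/andP; split; lra.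
have := he (1 - y); rewrite /= subKr gtr0_norm// => /(_ ye).
rewrite /dquot (CI_1 P) gtrBl => /(_ y0).
have -> : 1 - y - 1 = - y by ring.
rewrite invrN mulrN -mulNr opprB ltr_pdivlMr// => /ltW; exact.
Qed.

End Extension.

(** * Construction of a stationary distribution function *)

Section StationaryCdf.
Context {R : realType}.
Variables (f : RDS R) (G0 K0 G1 K1 : R -> R).
Hypotheses (e0 : extension (rds0 f) G0 K0) (e1 : extension (rds1 f) G1 K1).
Local Notation p := (rdsp f).
Implicit Types (x e d : R).

Lemma stationary_cdf_exists : exists F : R -> R,
  [/\ {homo F : x y / x <= y}, usc_right F, 
      forall x, transfer p K0 K1 F x = F x &
    [/\ forall x, x <= 0 -> F x = 0, forall x, 1 <= x -> F x = 1 &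
        forall e, 0 < e -> exists2 d, 0 < d & 1 - e < F (1 - d)]].
Proof.
have p01 := rdsp_itv f.
have [GK0 _ _] := e0; have [GK1 _ _] := e1.
have [G00 G01 _ _] := extension_out01 e0.
have [G10 G11 _ _] := extension_out01 e1.
have [Phi [mPhi uPhi supPhi [Phi0 Phi1 Phi01]]] :=
  supersolution_of_slopes GK0 GK1 G00 G10 p01 (rds_Lambda0 f)
    (fun c => CI_lower_bound0 e0 (c := c)) (fun c => CI_lower_bound0 e1 (c := c)).
(* Conjugation by x -> 1 - x moves the endpoint 1 to 0, where the same construction applies with
   [rds_Lambda1]. *)
pose G0' x := 1 - G0 (1 - x); pose K0' x := 1 - K0 (1 - x).
pose G1' x := 1 - G1 (1 - x); pose K1' x := 1 - K1 (1 - x).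
have GK0' : increasing_bij G0' K0' := increasing_bij_reflect GK0.
have GK1' : increasing_bij G1' K1' := increasing_bij_reflect GK1.
have G00' : G0' 0 = 0 by rewrite /G0' subr0 G01 subrr.
have G10' : G1' 0 = 0 by rewrite /G1' subr0 G11 subrr.
have [Phi' [mPhi' uPhi' supPhi' [Phi'0 Phi'1 Phi'01]]] :=
  supersolution_of_slopes GK0' GK1' G00' G10' p01 (rds_Lambda1 f)
    (fun c => CI_lower_bound1 e0 (c := c)) (fun c => CI_lower_bound1 e1 (c := c)).
pose Psi x := 1 - Phi' (1 - x).
have subPsi x : Psi x <= transfer p K0 K1 Psi x.
  have -> : transfer p K0 K1 Psi x = 1 - transfer p K0' K1' Phi' (1 - x).
    by rewrite /transfer /Psi /K0' /K1' subKr; ring.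
  by rewrite lerD2l lerN2.
(* On the left half [Psi] vanishes; on the right half [Phi] is 1. *)
have PsiPhi x : Psi x <= Phi x.
  have [x1|x1] := leP x (1 / 2).
    rewrite /Psi Phi'1; last lra.
    by rewrite subrr -(Phi0 (Num.min 0 x)) ?mPhi// ge_min lexx ?orbT.
  rewrite /Psi Phi1; last exact: ltW.
  have /andP[h _] := Phi'01 (1 - x); lra.
have [F [mF uF TF PF]] := transfer_fixpoint p01 GK0 GK1 mPhi uPhi supPhi subPsi PsiPhi.
exists F; split => //; split.
- move=> x x0; have /andP[h1 h2] := PF x.
  apply/eqP; rewrite eq_le -{1}(Phi0 x x0) h2 /=; apply: le_trans h1.
  by rewrite /Psi; have /andP[_ h] := Phi'01 (1 - x); lra.
- move=> x x1; have /andP[h1 h2] := PF x.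
  apply/eqP; rewrite eq_le; have /andP[_ h3] := Phi01 x.
  rewrite (le_trans h2 h3) /=; apply: le_trans h1.
  by rewrite /Psi Phi'0 ?subr0//; lra.
(* Right-continuity of [Phi'] at 0 makes [Psi] close to 1 near 1, so no mass escapes to the
   endpoint. *)
- move=> e /(uPhi' 0)[d d0]; rewrite add0r (Phi'0 0)// add0r => h.
  exists d => //; have /andP[h1 _] := PF (1 - d).
  by apply: lt_le_trans h1; rewrite /Psi subKr; lra.
Qed.

End StationaryCdf.

(** * Stationary measures *)

Section StationaryMeasure.
Context {R : realType}.
Local Notation T := (measurableTypeR R).
Implicit Types (x e d : R) (nu : probability T R).

Lemma extension_preimage (f G K : R -> R) (A : set R) : extension f G K ->
  A `<=` O01 R -> O01 R `&` f @^-1` A = G @^-1` A.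
Proof.
move=> ext sA; have [_ Gf _] := ext; apply/seteqP; split => x /=.
  rewrite /O01/= in_itv/= => -[/andP[x0 x1]]; rewrite Gf//.
  by apply/andP; split; exact: ltW.
move=> /[dup] /sA; rewrite /O01/= in_itv/= (extension_fun01 _ ext) => x01.
have /andP[x0 x1] := x01.
rewrite Gf; last by apply/andP; split; exact: ltW.
by rewrite in_itv.
Qed.

Lemma extension_preimage_itv (f G K : R -> R) x : extension f G K ->
  O01 R `&` f @^-1` (O01 R `&` `]-oo, x]) = O01 R `&` `]-oo, K x].
Proof.
move=> ext; rewrite (extension_preimage ext); last by move=> y [].
have [GK _ _] := ext; apply/seteqP; split => y /=;
  by rewrite /O01/= !in_itv/= (extension_fun01 _ ext) (increasing_bij_swap_le _ _ GK).
Qed.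

Lemma measurable_O01 : measurable (O01 R : set T).
Proof. exact: measurable_itv. Qed.

Lemma increasing_bij_measurable (G K : R -> R) :
  increasing_bij G K -> measurable_fun setT (G : T -> T).
Proof.
by move=> [mG _ _]; apply: nondecreasing_measurable => // x y; rewrite mG.
Qed.

Lemma increasing_bij_preimage_itv (G K : R -> R) x :
  increasing_bij G K -> G @^-1` `]-oo, x] = `]-oo, K x]%classic.
Proof.
move=> GK; apply/seteqP; split => y /=;
  by rewrite !in_itv/= (increasing_bij_swap_le _ _ GK).
Qed.

Lemma restrict_O01 nu (A : set T) : nu (O01 R) = 1%E ->
  measurable A -> nu A = nu (O01 R `&` A).
Proof.
move=> nuO mA.
have mO := measurable_O01.
have : nu (~` O01 R) = 0%E by rewrite probability_setC// nuO subee.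
move=> nuC.
rewrite [LHS](measureDI _ mA mO) setIC [X in (X + _)%E](_ : _ = 0%E) ?add0e//.
apply/eqP; rewrite eq_le measure_ge0 andbT -[leRHS]nuC.
by apply: le_measure; rewrite ?inE//; [exact: measurableD | exact: measurableC].
Qed.

Definition cdf_fun nu x : R := fine (nu `]-oo, x]%classic).

Lemma cdf_funE nu x : nu `]-oo, x]%classic = (cdf_fun nu x)%:E.
Proof. by rewrite fineK// fin_num_measure. Qed.

Lemma cdf_fun_itv nu x : 0 <= cdf_fun nu x <= 1.
Proof. by rewrite -!lee_fin -cdf_funE measure_ge0 probability_le1. Qed.

Lemma cdf_fun_homo nu : {homo cdf_fun nu : x y / x <= y}.
Proof.
move=> x y xy; rewrite -lee_fin -!cdf_funE le_measure ?inE//.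
exact: subset_itvl.
Qed.

Lemma cdf_fun_out nu : nu (O01 R) = 1%E ->
  (forall x, x <= 0 -> cdf_fun nu x = 0) /\ (forall x, 1 <= x -> cdf_fun nu x = 1).
Proof.
move=> nuO; split => x hx; apply: EFin_inj; rewrite -cdf_funE (restrict_O01 nuO)//.
  rewrite [X in nu X](_ : _ = set0) ?measure0// -subset0 => y.
  by rewrite /O01/= !in_itv/= => -[/andP[y0 _]]; rewrite leNgt (le_lt_trans hx y0).
rewrite setIidl// => y; rewrite /O01/= !in_itv/= => /andP[_ y1].
exact: ltW (lt_le_trans y1 hx).
Qed.

Lemma cdf_fun_near0 nu e : nu (O01 R) = 1%E -> 0 < e ->
  exists2 d, 0 < d & forall x, x < d -> cdf_fun nu x < e.
Proof.
move=> nuO e_gt0; have [h0 _] := cdf_fun_out nuO.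
(* The summand 0 gives the intervals the shape expected by [itvNycEbigcap], by which they decrease
   to the closed half-line ending at 0. *)
pose A n : set T := `]-oo, (0 + n.+1%:R^-1)%R]%classic.
have mA n : measurable (A n) by exact: measurable_itv.
have : nu (A n) @[n --> \oo] --> nu (\bigcap_n A n).
  apply: nonincreasing_cvg_mu.
  - by rewrite -ge0_fin_numE// fin_num_measure.
  - by [].
  - exact: bigcap_measurable.
  - move=> m n mn; apply/subsetPset; apply: subset_itvl.
    by rewrite bnd_simp lerD2l lef_pV2 ?posrE// ler_nat.
rewrite -itvNycEbigcap cdf_funE h0// => /fine_cvgP[_] /cvgr_lt/(_ _ e_gt0).
move=> [n _ /(_ n (leqnn n))/= h]; exists n.+1%:R^-1; first by rewrite invr_gt0.
move=> x xn; apply: le_lt_trans h; rewrite -/(cdf_fun nu _); apply: cdf_fun_homo.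
by rewrite add0r ltW.
Qed.

Lemma cdf_fun_near1 nu e : nu (O01 R) = 1%E -> 0 < e ->
  exists2 d, 0 < d & forall x, 1 - d < x -> 1 - e < cdf_fun nu x.
Proof.
move=> nuO e_gt0.
pose A n : set T := `]-oo, (1 - n.+1%:R^-1)%R]%classic.
have AE : \bigcup_n A n = `]-oo, 1[%classic.
  apply/seteqP; split => x /=.
    move=> [n _]; rewrite /A/= !in_itv/= => /le_lt_trans; apply.
    by rewrite gtrBl invr_gt0.
  rewrite in_itv/= => x1; exists (Num.truncn (1 - x)^-1) => //.
  rewrite /A /= in_itv/= lerBrDl -lerBrDr.
  rewrite -[leRHS]invrK lef_pV2 ?posrE ?invr_gt0 ?subr_gt0//.
  exact/ltW/truncnS_gt.
have mA n : measurable (A n) by exact: measurable_itv.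
have : nu (A n) @[n --> \oo] --> nu (\bigcup_n A n).
  apply: nondecreasing_cvg_mu => //; first exact: bigcup_measurable.
  move=> m n mn; apply/subsetPset; apply: subset_itvl.
  by rewrite bnd_simp lerD2l lerN2 lef_pV2 ?posrE// ler_nat.
have -> : nu (\bigcup_n A n) = 1%E.
  rewrite AE (restrict_O01 nuO) // setIidl// => y.
  by rewrite /O01/= !in_itv/= => /andP[].
move=> /fine_cvgP[_] /cvgr_gt/(_ (1 - e)); rewrite gtrBl => /(_ e_gt0).
move=> [n _ /(_ n (leqnn n))/= h]; exists n.+1%:R^-1; first by rewrite invr_gt0.
move=> x xn; apply: (lt_le_trans h); rewrite -/(cdf_fun nu _); apply: cdf_fun_homo.
exact: ltW.
Qed.

Section FixedSystem.
Variables (f : RDS R) (G0 K0 G1 K1 : R -> R).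
Hypotheses (e0 : extension (rds0 f) G0 K0) (e1 : extension (rds1 f) G1 K1).
Local Notation p := (rdsp f).

(** Both sides of the stationarity equation are measures in [A]. On half-lines ending at [x] they
    take the values [F x] and [transfer p K0 K1 F x], so they agree on Borel sets. *)
Lemma stationary_of_cdf (mu : probability T R) (F : R -> R) :
  (forall x, mu `]-oo, x]%classic = (F x)%:E) ->
  (forall x, transfer p K0 K1 F x = F x) ->
  (forall x, x <= 0 -> F x = 0) ->
  (forall e, 0 < e -> exists2 d, 0 < d & 1 - e < F (1 - d)) ->
  stationary f mu.
Proof.
move=> muF TF F0 F1.
have [GK0 _ _] := e0; have [GK1 _ _] := e1.
have /andP[p0 p1] := rdsp_itv f.
have mO := measurable_O01.
have muO : mu (O01 R) = 1%E.
  apply/eqP; rewrite eq_le probability_le1//=.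
  apply/lee_addgt0Pr => e e0'; have [d d0 hd] := F1 _ e0'.
  (* If [d >= 1] then [F (1 - d)] is 0, which forces [e > 1] and the bound is trivial. Otherwise the
     half-line up to [1 - d] is covered by (0, 1) and a half-line of mass [F 0 = 0]. *)
  have [d1|d1] := leP 1 d.
    have : 1 < e by move: hd; rewrite F0; lra.
    move=> e1'; apply: (@le_trans _ _ e%:E); first by rewrite lee_fin ltW.
    by rewrite leeDr.
  rewrite -leeBlDr// -EFinB.
  have : (mu `]-oo, (1 - d)%R]%classic <= mu (`]-oo, 0%R]%classic `|` O01 R))%E.
    apply: le_measure; rewrite ?inE//.
      exact: measurableU.
    move=> x /=; rewrite /O01/= !in_itv/= => xd.
    case: (leP x 0) => x0; [by left|right].
    by apply: (le_lt_trans xd); lra.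
  rewrite measureU//; last first.
    rewrite -subset0 => x /=; rewrite /O01/= !in_itv/= => -[x0 /andP[]].
    by rewrite ltNge x0.
  rewrite muF => h; apply: le_trans (le_trans h _); last first.
    rewrite -[leRHS]add0e; apply: leeD => //.
    by have := muF 0; rewrite F0// => h0; rewrite -[leRHS]h0.
  by rewrite lee_fin ltW.
split => // A mA sA.
have q0 : 0 <= 1 - p by lra.
have mG0 := increasing_bij_measurable GK0.
have mG1 := increasing_bij_measurable GK1.
pose X0 : {mfun T >-> T} :=
  HB.pack (G0 : T -> T) (isMeasurableFun.Build _ _ T T G0 mG0).
pose X1 : {mfun T >-> T} :=
  HB.pack (G1 : T -> T) (isMeasurableFun.Build _ _ T T G1 mG1).
pose m0 := distribution mu X0; pose m1 := distribution mu X1.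
pose M := measure_add (mscale (NngNum (ltW p0)) m0) (mscale (NngNum q0) m1).
have ME B : M B = (p%:E * mu (G0 @^-1` B) + (1 - p)%:E * mu (G1 @^-1` B))%E.
  by rewrite /M measure_addE.
rewrite (extension_preimage e0)// (extension_preimage e1)// -ME.
apply: measure_eq_cdf => // x.
  apply: etrans (muF x) _; rewrite [RHS]ME (increasing_bij_preimage_itv _ GK0).
  rewrite (increasing_bij_preimage_itv _ GK1) !muF -!EFinM -EFinD.
  by congr EFin; exact/esym/TF.
by have := ltry (F x); rewrite -muF.
Qed.

Lemma stationary_cdf_fun nu : stationary f nu ->
  forall x, transfer p K0 K1 (cdf_fun nu) x = cdf_fun nu x.
Proof.
move=> [nuO nuS] x; apply: EFin_inj; rewrite -[RHS]cdf_funE (restrict_O01 nuO)//.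
rewrite nuS; last 2 first.
- by apply: measurableI => //; exact: measurable_O01.
- by move=> y [].
rewrite (extension_preimage_itv _ e0) (extension_preimage_itv _ e1).
by rewrite -!(restrict_O01 nuO)// !cdf_funE.
Qed.

(** The difference of the two distribution functions is fixed by [transfer]. It is small near 0
    because that of [nu] is, and nearly nonpositive near 1 because that of [mu] tends to 1; the
    maximum principle applies. *)
Lemma stationary_cdf_le nu (mu : probability T R) :
  stationary f nu -> stationary f mu ->
  forall x, cdf_fun nu x <= cdf_fun mu x.
Proof.
move=> snu smu x; rewrite -subr_le0.
have [nuO _] := snu; have [muO _] := smu.
have [GK0 _ _] := e0; have [GK1 G1f _] := e1.
pose D y := cdf_fun nu y - cdf_fun mu y.
apply: (@transfer_max_principle _ p K0 K1 G1 (rdsp_itv f) GK1 _ D).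
- move=> y y01; have := y01; rewrite -(extension_inv01 e1) => /andP[K1y _].
  rewrite K1y /= (increasing_bij_swap_lt _ _ (increasing_bij_sym GK1)).
  rewrite G1f; first exact: rds1_gt.
  by case/andP: y01 => *; apply/andP; split; exact: ltW.
- exists 1 => y; rewrite /D; have /andP[_ h] := cdf_fun_itv nu y.
  by have /andP[h' _] := cdf_fun_itv mu y; lra.
- move=> y; have h1 := stationary_cdf_fun snu y; have h2 := stationary_cdf_fun smu y.
  by rewrite /D -h1 -h2 /transfer; ring.
- move=> e e_gt0; have [d d0 h] := cdf_fun_near0 nuO e_gt0; exists d => // y /h.
  by have /andP[h' _] := cdf_fun_itv mu y; rewrite /D; lra.
- move=> e e_gt0; have [d d0 h] := cdf_fun_near1 muO e_gt0; exists d => // y /h.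
  by have /andP[_ h'] := cdf_fun_itv nu y; rewrite /D; lra.
Qed.

End FixedSystem.

Theorem unique_stationary_exists (f : RDS R) : exists mu, unique_stationary f mu.
Proof.
have [G0 [K0 e0]] := CI_extension (rds0_homeo f).
have [G1 [K1 e1]] := CI_extension (rds1_homeo f).
have [F [mF uF TF [F0 F1 Fl]]] := stationary_cdf_exists e0 e1.
have [mu muF] := probability_of_cdf mF uF F0 F1.
have smu := stationary_of_cdf e0 e1 muF TF F0 Fl.
exists mu; split => // nu snu; apply: measure_eq_cdf => x.
  apply: etrans (cdf_funE nu x) (etrans _ (esym (cdf_funE mu x))).
  by congr EFin; apply/eqP; rewrite eq_le !(stationary_cdf_le e0 e1).
by have := ltry (cdf_fun nu x); rewrite -cdf_funE.
Qed.

End StationaryMeasure.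

(** * Full support from an irrational ratio of slopes *)

Section Kronecker.
Context {R : realType}.
Implicit Types (a b x e : R).

(** Dirichlet's pigeonhole: among N + 1 fractional parts of multiples of [b / a], two share one of N
    boxes of length 1 / N. Their difference times [a] is the combination, nonzero by
    irrationality. *)
Lemma small_combination a b e : 0 < a -> 0 < b ->
  (forall m n : nat, (0 < n)%N -> n%:R * b != m%:R * a) -> 0 < e ->
  exists m n : nat, 0 < `|n%:R * b - m%:R * a| < e.
Proof.
move=> a0 b0 irr e0.
pose t (k : nat) : nat := Num.truncn (k%:R * b / a).
pose fr k : R := k%:R * b / a - (t k)%:R.
have kb0 (k : nat) : 0 <= k%:R * b / a.
  by rewrite divr_ge0 ?mulr_ge0 ?(ltW a0) ?(ltW b0).
have fr01 k : 0 <= fr k < 1.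
  have /andP[h1 h2] := truncn_itv (kb0 k).
  by rewrite /fr subr_ge0 h1 /= ltrBlDl natr1.
pose N := (Num.truncn (a / e)).+1.
have N0 : (0 : R) < N%:R by rewrite ltr0n.
have aN : a < N%:R * e.
  by rewrite -ltr_pdivrMr//; exact: truncnS_gt.
have box (k : 'I_N.+1) : (Num.truncn (N%:R * fr k) < N)%N.
  have /andP[h1 h2] := fr01 k.
  have /truncn_itv/andP[h _] : 0 <= N%:R * fr k by rewrite mulr_ge0// ltW.
  by rewrite -(ltr_nat R); apply: (le_lt_trans h); rewrite gtr_pMr.
pose g k : 'I_N := Ordinal (box k).
have : ~~ injectiveb g.
  apply/negP => /injectiveP/leq_card; by rewrite !card_ord ltnn.
move=> /injectivePn[i [j ij gij]].
wlog {ij} ij : i j gij / (i < j)%N.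
  move=> h; have := ij; rewrite -(inj_eq val_inj) /= neq_ltn => /orP[] hij.
    exact: (h i j).
  exact: (h j i).
(* Subtraction on [nat] truncates; this makes the first witness below a genuine difference. *)
have tij : (t i <= t j)%N.
  apply: Num.Theory.le_truncn; rewrite !ler_pM2r ?invr_gt0// ler_nat.
  exact: ltnW.
exists (t j - t i)%N, (j - i)%N.
rewrite normr_gt0 subr_eq0 irr ?subn_gt0//=.
have -> : (j - i)%:R * b - (t j - t i)%:R * a = a * (fr j - fr i).
  rewrite !natrB ?(ltnW ij)// /fr; field; rewrite gt_eqF//.
rewrite normrM (gtr0_norm a0) -(ltr_pM2l N0); apply: lt_trans aN.
have Nfr k : 0 <= N%:R * fr k.
  by rewrite mulr_ge0 ?(ltW N0)//; case/andP: (fr01 k).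
have /andP[i1 i2] := truncn_itv (Nfr i).
have /andP[j1 j2] := truncn_itv (Nfr j).
move: gij => /(congr1 val)/= gij; rewrite gij in i1 i2.
have -> : N%:R * (a * `|fr j - fr i|) = a * `|N%:R * fr j - N%:R * fr i|.
  by rewrite -mulrBr normrM (gtr0_norm N0); ring.
rewrite gtr_pMr// ltr_norml; apply/andP.
by move: i2 j2; rewrite -natr1; split; lra.
Qed.

(** Multiples of a small combination w approximate any target on their side of the starting point.
    The sign of w is not known: if w > 0, start from a multiple of [- a] below [x] and climb; if w <
    0, start from a multiple of [b] above [x] and descend. All coefficients stay natural. *)
Lemma kronecker_combination a b x e : 0 < a -> 0 < b ->
  (forall m n : nat, (0 < n)%N -> n%:R * b != m%:R * a) -> 0 < e ->
  exists m n : nat, `|n%:R * b - m%:R * a - x| < e.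
Proof.
move=> a0 b0 irr e0.
have [m [n]] := small_combination a0 b0 irr e0; set w := _ - _ => /andP[w0 we].
have step (y : R) : 0 <= y -> exists k : nat, k%:R * `|w| <= y < k.+1%:R * `|w|.
  move=> y0; exists (Num.truncn (y / `|w|)).
  have /andP[h1 h2] := truncn_itv (divr_ge0 y0 (ltW w0)).
  by rewrite -ler_pdivlMr// h1 -ltr_pdivrMr.
have large (c y : R) : 0 < c -> exists M : nat, 0 <= M%:R * c + y.
  move=> c0; exists (Num.truncn (`|y| / c)).+1.
  have : `|y| / c < (Num.truncn (`|y| / c)).+1%:R by exact: truncnS_gt.
  rewrite ltr_pdivrMr// => h; have := ler_norm (- y); rewrite normrN; lra.
have [w_gt0|w_le0] := ltP 0 w.
  have [M /step[k]] := large a x a0; rewrite gtr0_norm// -natr1 => /andP[h1 h2].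
  exists (M + k * m)%N, (k * n)%N; rewrite !natrD !natrM.
  rewrite gtr0_norm// in we.
  have -> : k%:R * n%:R * b - (M%:R + k%:R * m%:R) * a - x =
      k%:R * w - (M%:R * a + x).
    by rewrite /w; ring.
  by rewrite ler0_norm; lra.
have [N /step[k]] := large b (- x) b0; rewrite ler0_norm// -natr1 => /andP[h1 h2].
exists (k * m)%N, (N + k * n)%N; rewrite !natrD !natrM.
rewrite ler0_norm// in we.
have -> : (N%:R + k%:R * n%:R) * b - k%:R * m%:R * a - x =
    (N%:R * b - x) + k%:R * w.
  by rewrite /w; ring.
by rewrite ger0_norm; lra.
Qed.

End Kronecker.

(** * Dense orbits and full support *)

Section FullSupport.
Context {R : realType}.
Local Notation T := (measurableTypeR R).
Variables (f : RDS R) (G0 K0 G1 K1 : R -> R).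
Hypotheses (e0 : extension (rds0 f) G0 K0) (e1 : extension (rds1 f) G1 K1).
Local Notation p := (rdsp f).
Variables (d l0 l1 : R).
Hypotheses (d0 : 0 < d) (l0_lt0 : l0 < 0) (l1_gt0 : 0 < l1).
Hypothesis lin0 : forall x, 0 < x < d -> G0 x = expR l0 * x.
Hypothesis lin1 : forall x, 0 < x < d -> G1 x = expR l1 * x.
Hypothesis irr : forall m n : nat, (0 < n)%N -> n%:R * l1 != m%:R * - l0.
Implicit Types (x y u v e : R).

Lemma iter_linear0 y m : 0 < y < d -> iter m G0 y = expR (m%:R * l0) * y.
Proof.
move=> /andP[y0 yd]; elim: m => [|m ih]; first by rewrite mul0r expR0 mul1r.
rewrite iterS ih lin0.
  by rewrite mulrA -expRD -natr1; congr (expR _ * _); ring.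
rewrite mulr_gt0 ?expR_gt0//=; apply: le_lt_trans yd.
by rewrite ger_pMl// -expR0 ler_expR mulr_ge0_le0// ltW.
Qed.

Lemma iter_linear1 y n : 0 < y -> expR (n%:R * l1) * y < d ->
  iter n G1 y = expR (n%:R * l1) * y.
Proof.
move=> y0; elim: n => [|n ih] hd; first by rewrite mul0r expR0 mul1r.
have lt : expR (n%:R * l1) * y < d.
  apply: le_lt_trans hd; rewrite ler_pM2r// ler_expR ler_pM2r// ler_nat.
  exact: leqnSn.
rewrite iterS ih// lin1; last by rewrite lt mulr_gt0 ?expR_gt0.
by rewrite mulrA -expRD -natr1; congr (expR _ * _); ring.
Qed.

Lemma orbit_near0_dense y a c : 0 < y < d -> 0 < a -> a < c -> c <= d ->
  exists m n, a < iter n G1 (iter m G0 y) < c.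
Proof.
move=> yd a0 ac cd; have /andP[y0 _] := yd; have c0 := lt_trans a0 ac.
have lnac : ln a < ln c by rewrite ltr_ln ?posrE.
have e_gt0 : 0 < (ln c - ln a) / 2 by rewrite divr_gt0// subr_gt0.
have nl0 : 0 < - l0 by rewrite oppr_gt0.
(* In logarithmic coordinates the word adds [n%:R * l1 + m%:R * l0] to [ln y]; the target is the
   midpoint of [ln a] and [ln c]. *)
have [m [n]] :=
  kronecker_combination ((ln c + ln a) / 2 - ln y) nl0 l1_gt0 irr e_gt0.
rewrite ltr_norml => /andP[h1 h2].
set z := expR (n%:R * l1) * (expR (m%:R * l0) * y).
have zE : z = expR (n%:R * l1 + m%:R * l0 + ln y).
  by rewrite /z !expRD lnK ?posrE// mulrA.
have za : a < z by rewrite zE -[ltLHS](lnK a0) ltr_expR; lra.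
have zc : z < c by rewrite zE -[ltRHS](lnK c0) ltr_expR; lra.
exists m, n; rewrite iter_linear0// iter_linear1 -/z ?za//.
  by rewrite mulr_gt0 ?expR_gt0.
exact: lt_le_trans cd.
Qed.

Lemma extension_contracts0 x : 0 < x < 1 -> 0 < G0 x < x.
Proof.
move=> x01; have := x01; rewrite -(extension_fun01 _ e0) => /andP[-> _] /=.
have [_ G0f _] := e0; rewrite G0f; first exact: rds0_lt.
by case/andP: x01 => *; apply/andP; split; exact: ltW.
Qed.

Lemma extension_contracts1 x : 0 < x < 1 -> 0 < K1 x < x.
Proof.
move=> x01; have := x01; rewrite -(extension_inv01 e1) => /andP[-> _] /=.
have [GK1 G1f _] := e1.
rewrite (increasing_bij_swap_lt _ _ (increasing_bij_sym GK1)) G1f.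
  exact: rds1_gt.
by case/andP: x01 => *; apply/andP; split; exact: ltW.
Qed.

(* The open set [U] is pulled back towards 0 by [K1], where both maps are
   linear; the orbit of [y] is brought there by [G0]. *)
Lemma orbit_meets_open (U : set R) y : open U -> U `<=` O01 R -> U !=set0 ->
  0 < y < 1 -> exists M N, U (iter N G1 (iter M G0 y)).
Proof.
move=> oU U01 [u Uu] y01.
have [GK0 _ _] := e0; have [GK1 _ _] := e1.
have [k yk] := iter_lt_near0 (increasing_bij_sym GK0) extension_contracts0 y01 d0.
have u01 : 0 < u < 1 by have := U01 _ Uu; rewrite /O01/= in_itv.
have [l /andP[v0 vd]] := iter_lt_near0 GK1 extension_contracts1 u01 d0.
have [r /= r0 rU] : \forall x \near u, U x by exact: open_nbhs_nbhs.
have [mK _ KG] := increasing_bij_sym (iter_increasing_bij l GK1).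
have GKl := iter_increasing_bij l GK1.
have ltK := increasing_bij_lt (increasing_bij_sym GKl).
set v := iter l K1 u in v0 vd.
(* [a] and [c] bound the pullback of the [r]-neighbourhood of [u], trimmed by [v / 2] to stay
   positive and by [d] to stay in the linear zone. *)
pose a := Num.max (iter l K1 (u - r)) (v / 2).
pose c := Num.min (iter l K1 (u + r)) d.
have av : a < v.
  by rewrite gt_max {1}/v ltK; apply/andP; split; lra.
have vc : v < c by rewrite lt_min {1}/v ltK vd andbT; lra.
have a0 : 0 < a by rewrite lt_max divr_gt0 ?orbT.
have cd : c <= d by rewrite ge_min lexx orbT.
have [m [n]] := orbit_near0_dense yk a0 (lt_trans av vc) cd.
rewrite gt_max lt_min => /andP[/andP[h1 _] /andP[h2 _]].
exists (m + k)%N, (l + n)%N; rewrite !iterD; apply: rU.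
move: h1 h2; rewrite (increasing_bij_swap_lt _ _ (increasing_bij_sym GKl)).
rewrite -(increasing_bij_swap_lt _ _ GKl) /= => h1 h2.
by rewrite ltr_norml; lra.
Qed.

Variable mu : probability T R.
Hypothesis mu_stat : stationary f mu.

(** The first two clauses are what stationarity requires of a set, so that it can be applied again
    to the preimages. *)
Let null (A : set T) := [/\ measurable A, A `<=` O01 R & mu A = 0%E].

(** Stationarity writes 0 as a sum of two nonnegative terms with positive weights, so both masses
    vanish. *)
Lemma null_preimage (A : set T) : null A -> null (G0 @^-1` A) /\ null (G1 @^-1` A).
Proof.
move=> [mA sA muA]; have [_ muS] := mu_stat.
have [GK0 _ _] := e0; have [GK1 _ _] := e1.
have mG0 : measurable (G0 @^-1` A).
  by rewrite -[X in measurable X]setTI;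
    exact: increasing_bij_measurable GK0 _ _ mA.
have mG1 : measurable (G1 @^-1` A).
  by rewrite -[X in measurable X]setTI;
    exact: increasing_bij_measurable GK1 _ _ mA.
have sG0 : G0 @^-1` A `<=` O01 R.
  by rewrite -(extension_preimage e0 sA) => x [].
have sG1 : G1 @^-1` A `<=` O01 R.
  by rewrite -(extension_preimage e1 sA) => x [].
have /andP[p0 p1] := rdsp_itv f.
have := muS A mA sA; rewrite muA (extension_preimage e0 sA) (extension_preimage e1 sA).
move=> /esym/eqP; rewrite padde_eq0; last 2 first.
- by rewrite mule_ge0// lee_fin ltW.
- by rewrite mule_ge0// lee_fin subr_ge0 ltW.
rewrite !mule_eq0 !eqe (gt_eqF p0) subr_eq0 (gt_eqF p1) /=.
by move=> /andP[/eqP h0 /eqP h1]; split; split.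
Qed.

Lemma null_preimage_iter (A : set T) m n : null A ->
  null ((fun x => iter n G1 (iter m G0 x)) @^-1` A).
Proof.
move=> nA; have : null (iter n G1 @^-1` A).
  elim: n A nA => // n ih A nA; apply: (ih (G1 @^-1` A)).
  by case: (null_preimage nA).
change (null (iter n G1 @^-1` A) -> null (iter m G0 @^-1` (iter n G1 @^-1` A))).
move: (iter n G1 @^-1` A) => B; elim: m B => // m ih B nB.
by apply: (ih (G0 @^-1` B)); case: (null_preimage nB).
Qed.

Lemma stationary_full_support : full_support mu.
Proof.
move=> U oU U01 Une; have [muO _] := mu_stat.
rewrite lt_neqAle measure_ge0 andbT; apply/eqP => muU.
have nU : null U by split => //; exact: open_measurable.
pose W m n := (fun x => iter n G1 (iter m G0 x)) @^-1` U : set T.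
have nW m n : null (W m n) by exact: null_preimage_iter.
(* Countably many null preimages of [U] cover (0, 1), contradicting mass 1. *)
have : mu.-negligible (O01 R).
  apply: (@negligibleS _ _ _ mu (\bigcup_m \bigcup_n W m n)).
    move=> y; rewrite /O01/= in_itv/= => y01.
    by have [m [n h]] := orbit_meets_open oU U01 Une y01; exists m => //; exists n.
  apply: negligible_bigcup => m; apply: negligible_bigcup => n.
  by have [mW _ W0] := nW m n; exists (W m n); split.
move=> [B [mB muB sB]].
have : (mu (O01 R) <= mu B)%E.
  by apply: le_measure; rewrite ?inE//; exact: measurable_O01.
by rewrite muO muB leNgt lte_fin ltr01.
Qed.

End FullSupport.

(** * Perturbation near 0 *)

Section Perturbation.
Context {R : realType}.
Implicit Types (f g : R -> R) (x y d e l : R).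

Lemma increasing_homeo g : g 0 = 0 -> g 1 = 1 ->
  {within I01 R, continuous g} -> {in `[0, 1] &, {mono g : x y / x <= y}} ->
  [/\ homeo_I g, g @` I01 R = I01 R & g @` O01 R `<=` O01 R].
Proof.
move=> g0 g1 cg mg.
have lt_g := leW_mono_in mg.
have in0 : (0 : R) \in `[0, 1] by rewrite in_itv/= lexx ler01.
have in1 : (1 : R) \in `[0, 1] by rewrite in_itv/= lexx ler01.
have stable x : x \in `[0, 1] -> g x \in `[0, 1].
  move=> x01; rewrite in_itv/= -[X in X <= g x]g0 -[X in g x <= X]g1 !mg//.
have surj : set_surj (I01 R) (I01 R) g.
  have := segment_continuous_le_surjective (@ler01 R) _ cg.
  by rewrite g0 g1; apply.
have inj : {in I01 R &, injective g}.
  move=> x y; rewrite !inE => x01 y01 gxy.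
  by apply/eqP; rewrite eq_le -!(mg x y) -?(mg y x) ?gxy ?lexx.
have bij : set_bij (I01 R) (I01 R) g by split => // x; exact: stable.
split.
(* The inverse is chosen pointwise; the default 0 is only taken outside I. *)
- split => //; pose k y := xget 0 [set x | I01 R x /\ g x = y].
  have gk x : x \in `[0, 1] -> k (g x) = x.
    move=> x01; rewrite /k; case: xgetP => [z _ [z01 gz]|].
      by apply: inj gz; rewrite inE.
    by move=> /(_ x); case.
  exists k => //.
  have := segment_can_le_continuous (@ler01 R) cg gk.
  by rewrite g0 g1.
- apply/seteqP; split => [_ [x x01 <-]|y /surj//]; exact: stable.
- move=> _ [x + <-]; rewrite /O01/= !in_itv/= => /andP[x0 x1].
  have x01 : x \in `[0, 1] by rewrite in_itv/= !ltW.
  by rewrite -[X in X < g x]g0 -[X in g x < X]g1 !lt_g// x0.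
Qed.

(** The auxiliary line is at most 0 up to [d / 2] and reaches 1 at [d]: the maximum is linear of
    slope e^l near 0, and the minimum returns to [f] from [d] on. Combining increasing continuous
    functions by min and max avoids any gluing. *)
Definition flatten f l d x : R :=
  Num.min (f x) (Num.max (expR l * x) (2 / d * x - 1)).

Lemma flatten_le f l d x : flatten f l d x <= f x.
Proof. by rewrite ge_min lexx. Qed.

Lemma flatten_ge f l d x : Num.min (f x) (expR l * x) <= flatten f l d x.
Proof. by rewrite le_min !ge_min !le_max !lexx !orbT. Qed.

Lemma flatten_eq f l d x : 0 < d -> d <= x -> f x <= 1 -> flatten f l d x = f x.
Proof.
move=> d0 dx fx1; apply/min_idPl; rewrite le_max; apply/orP; right.
apply: (le_trans fx1); have : 2 <= 2 / d * x.
  by rewrite -mulrA ler_pMr// mulrC ler_pdivlMr// mul1r.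
lra.
Qed.

Lemma flatten_linear f l d x : 0 < x -> x < d / 2 -> expR l * x <= f x ->
  flatten f l d x = expR l * x.
Proof.
move=> x0 xd fx; have d0 : 0 < d by lra.
rewrite /flatten max_l; first exact/min_idPr.
apply: (@le_trans _ _ 0); last by rewrite mulr_ge0 ?expR_ge0 ?ltW.
have : 2 / d * x <= 1 by rewrite mulrAC ler_pdivrMr// mul1r; lra.
lra.
Qed.

(** Where the two maps differ, both lie between the lines of slopes e^l and [S], and below 1/2,
    where [dh] is a difference of logarithms; this difference is at most ln S - l < 2e. *)
Lemma CI_flatten (f : CI R) l e : homeo_I f -> 0 < e ->
  ln (derive_at0 f) - e < l < ln (derive_at0 f) ->
  exists g : CI R, [/\ homeo_I g, derive_at0 g = expR l,
    derive_at1 g = derive_at1 f &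
    [/\ exists2 d, 0 < d & forall x, 0 < x < d -> g x = expR l * x,
      forall x, 0 < x < 1 -> Num.min (f x) (expR l * x) <= g x <= f x &
      (dCI f g <= (2 * e)%:E)%E]].
Proof.
move=> hf e0 /andP[le ls]; set s := derive_at0 f in le ls.
have P := CI_prop f; have s0 : 0 < s := CI_derive0_gt0 P.
pose S := expR (ln s + e).
have ls' : expR l < s by rewrite -(lnK s0) ltr_expR.
have sS : s < S by rewrite -{1}(lnK s0) ltr_expR ltrDl.
have [d1 /= d10 h1] : \forall x \near 0^'+, expR l < dquot f 0 x.
  exact: cvgr_gt (CI_derivable0 P) _ ls'.
have [d2 /= d20 h2] : \forall x \near 0^'+, dquot f 0 x < S.
  exact: cvgr_lt (CI_derivable0 P) _ sS.
have S0 : 0 < S by exact: expR_gt0.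
(* [d1] and [d2] bound the difference quotient, [1 / 2] keeps the change away from 1, and
   [1 / (2 * S)] keeps [f] below 1/2 on the modified part. *)
pose d := Num.min (Num.min d1 d2) (Num.min (1 / 2) (1 / (2 * S))).
have d0 : 0 < d by rewrite !lt_min d10 d20 !divr_gt0// mulr_gt0.
have dle : d <= 1 / 2 by rewrite !ge_min lexx !orbT.
have dS : d * (2 * S) <= 1.
  by rewrite -ler_pdivlMr ?mulr_gt0// !ge_min lexx !orbT.
have lo x : 0 < x < d -> expR l * x < f x < S * x.
  move=> /andP[x0]; rewrite !lt_min => /andP[/andP[x1 x2] _].
  have := h1 x; rewrite /= sub0r normrN gtr0_norm// => /(_ x1 x0).
  have := h2 x; rewrite /= sub0r normrN gtr0_norm// => /(_ x2 x0).
  by rewrite /dquot (CI_0 P) !subr0 ltr_pdivrMr// ltr_pdivlMr// => -> ->.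
pose g := flatten f l d.
have f01 x : x \in `[0, 1] -> 0 <= f x <= 1.
  move=> x01; have : I01 R (f x) by rewrite -(CI_onto P); exists x.
  by rewrite /I01/= in_itv.
have gf x : d <= x -> x <= 1 -> g x = f x.
  move=> dx x1; apply: flatten_eq => //.
  have /f01/andP[] // : x \in `[0, 1].
  by rewrite in_itv/= x1 andbT (le_trans (ltW d0)).
have g0 : g 0 = 0.
  rewrite /g /flatten (CI_0 P) !mulr0 sub0r.
  by rewrite max_l ?minxx// lerN10.
have g1 : g 1 = 1 by rewrite gf ?(CI_1 P)//; lra.
have cg : {within I01 R, continuous g}.
  have clin (a b : R) : {within I01 R, continuous (fun x : R => a * x + b)}.
    apply: continuous_subspaceT => x; apply: cvgD; last exact: cvg_cst.
    exact: mulrl_continuous.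
  move=> x; apply: (@continuous_min R (subspace (I01 R))).
    exact: CI_continuous P x.
  apply: (@continuous_max R (subspace (I01 R))).
    by apply: continuous_subspaceT x => y; exact: mulrl_continuous.
  exact: clin.
have mg : {in `[0, 1] &, {mono g : x y / x <= y}}.
  apply: le_mono_in => x y x01 y01 xy.
  have fxy : f x < f y by rewrite (leW_mono_in (CI_homo hf)).
  have lxy : expR l * x < expR l * y by rewrite ltr_pM2l ?expR_gt0.
  have dxy : 2 / d * x - 1 < 2 / d * y - 1.
    by rewrite ltrD2r ltr_pM2l ?divr_gt0.
  by rewrite /g /flatten lt_min !gt_min fxy /= !gt_max !lt_max lxy dxy !orbT.
have [hg og ig] := increasing_homeo g0 g1 cg mg.
have d20' : 0 < d / 2 by rewrite divr_gt0.
have glin x : 0 < x < d / 2 -> g x = expR l * x.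
  move=> /andP[x0 xd]; apply: flatten_linear => //.
  have /lo/andP[h _] : 0 < x < d by rewrite x0 /=; lra.
  exact: ltW h.
have c0 : dquot g 0 x @[x --> 0^'+] --> expR l.
  apply: cvg_near_cst; exists (d / 2) => //= x.
  rewrite /= sub0r normrN => + x0; rewrite gtr0_norm// => xd.
  by rewrite /dquot g0 !subr0 glin ?x0// mulfK ?gt_eqF.
have c1 : dquot g 1 x @[x --> 1^'-] --> derive_at1 f.
  apply: cvg_trans (CI_derivable1 P); apply: near_eq_cvg.
  exists (1 - d); first by rewrite /=; lra.
  move=> x; rewrite /= => + x1; rewrite gtr0_norm ?subr_gt0// => xd.
  by rewrite /dquot g1 (CI_1 P) gf//; [lra | exact: ltW].
have D0 : derive_at0 g = expR l by exact: cvg_lim c0.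
have D1 : derive_at1 g = derive_at1 f by exact: cvg_lim c1.
have ciG : is_CI g.
  split => //.
  - by apply/cvg_ex; exists (expR l).
  - by apply/cvg_ex; exists (derive_at1 f).
  - by rewrite D0 expR_gt0.
  - by rewrite D1; exact: CI_derive1_gt0 P.
exists (MkCI ciG); split => //; split.
- by exists (d / 2).
- by move=> x _; rewrite flatten_ge flatten_le.
apply: ge_ereal_sup => _ [x x01 <-]; rewrite lee_fin /=.
move: x01; rewrite /O01/= in_itv/= => /andP[x0 x1].
have [dx|xd] := leP d x.
  by rewrite gf ?(ltW x1)// /dh subrr normr0 mulr_ge0// ltW.
have /andP[lf fS] : expR l * x < f x < S * x by apply: lo; rewrite x0.
have lx0 : 0 < expR l * x by rewrite mulr_gt0 ?expR_gt0.
have fx0 := lt_trans lx0 lf.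
have gle := flatten_le f l d x : g x <= f x.
have gge : expR l * x <= g x.
  by apply: le_trans (flatten_ge f l d x); rewrite le_min ltW //=.
have gx0 := lt_le_trans lx0 gge.
have Sx : S * x <= 2^-1.
  have : S * x <= S * d by rewrite ler_pM2l// ltW.
  lra.
have fx2 : f x <= 2^-1 by apply: le_trans (ltW fS) Sx.
rewrite /dh /hfun fx2 (le_trans gle fx2).
have -> : ln (f x) - ln 2^-1 - (ln (g x) - ln 2^-1) = ln (f x) - ln (g x) by ring.
rewrite ger0_norm ?subr_ge0 ?ler_ln ?posrE//.
have : ln (f x) <= ln (S * x) by rewrite ler_ln ?posrE ?ltW// mulr_gt0.
have : ln (expR l * x) <= ln (g x) by rewrite ler_ln ?posrE.
rewrite !lnM ?posrE ?expR_gt0// !expRK; lra.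
Qed.

End Perturbation.

(** * Approximation by locally linear systems with irrational ratio of exponents *)

Section Density.
Context {R : realType}.
Implicit Types (f : RDS R) (l e x : R).

Lemma derive_at0_le1 (g : CI R) : (forall x, 0 < x < 1 -> g x < x) ->
  derive_at0 g <= 1.
Proof.
move=> gx; have P := CI_prop g.
apply: limr_le; first exact: CI_derivable0 P.
exists 1 => //= x; rewrite /= sub0r normrN => + x0; rewrite gtr0_norm// => x1.
rewrite /dquot (CI_0 P) !subr0 ler_pdivrMr// mul1r; apply/ltW/gx.
by rewrite x0.
Qed.

(** Take [t] to be a rational multiple of [pi * c]: a relation between multiples of [c] and [t]
    would make [pi] rational. *)
Lemma irrational_ratio_dense a b c : 0 < a < b -> 0 < c ->
  exists2 t : R, a < t < b &
    forall m n : nat, (0 < n)%N -> n%:R * c != m%:R * t.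
Proof.
move=> /andP[a0 ab] c0; have pc0 : 0 < pi * c by rewrite mulr_gt0// pi_gt0.
have oI : open (`](a / (pi * c)), (b / (pi * c))[%classic : set R).
  exact: interval_open.
have [|q [+ [r _ rq]]] := dense_rat _ oI.
  exists ((a / (pi * c) + b / (pi * c)) / 2); rewrite /= in_itv/=.
  have : a / (pi * c) < b / (pi * c) by rewrite ltr_pM2r ?invr_gt0.
  by move=> h; apply/andP; split; lra.
rewrite /= in_itv/= ltr_pdivrMr// ltr_pdivlMr// => /andP[aq qb].
exists (q * (pi * c)); first by rewrite aq.
move=> m n n0; apply/eqP => E.
have mq0 : m%:R * q != 0.
  apply/eqP => mq0; move: E; rewrite mulrA mq0 mul0r => /eqP.
  by rewrite mulf_eq0 (gt_eqF c0) orbF pnatr_eq0 -leqn0 leqNgt n0.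
have E' : n%:R * c = m%:R * q * pi * c by rewrite E; ring.
have /(mulIf (lt0r_neq0 c0)) npi := E'.
apply: (@pi_irrationnal R); exists (n%:R / (m%:R * r)) => //.
rewrite fmorph_div rmorphM/= !ratr_nat rq npi.
by rewrite mulrAC divff ?mul1r.
Qed.

Lemma locally_linear_approximation f e : 0 < e ->
  exists (g : RDS R) (d l0 l1 : R), [/\ (dm f g < e%:E)%E, 0 < d < 1,
    l0 < 0 < l1, forall m n : nat, (0 < n)%N -> n%:R * l1 != m%:R * - l0 &
    forall x, 0 < x < d -> rds0 g x = expR l0 * x /\ rds1 g x = expR l1 * x].
Proof.
move=> e_gt0; set p := rdsp f; have /andP[p0 p1] : 0 < p < 1 := rdsp_itv f.
have P0 := CI_prop (rds0 f); have P1 := CI_prop (rds1 f).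
pose s0 := ln (derive_at0 (rds0 f)); pose s1 := ln (derive_at0 (rds1 f)).
have L0 : 0 < p * s0 + (1 - p) * s1 := rds_Lambda0 f.
set L := _ + _ in L0.
have s0_le0 : s0 <= 0.
  by apply: ln_le0; exact: derive_at0_le1 (@rds0_lt _ f).
have s1_gt0 : 0 < s1.
  have : p * s0 <= 0 by rewrite mulr_ge0_le0// ltW.
  move=> h; rewrite -(pmulr_rgt0 _ (_ : 0 < 1 - p)); last lra.
  by move: L0; rewrite /L; lra.
(* Both exponents will drop by less than [c]: [e / 4] makes the distance [2 * c] less than [e], [L]
   keeps the mean exponent at 0 positive, and [s1] keeps [l1] positive. *)
pose c := Num.min (e / 4) (Num.min L s1).
have c0 : 0 < c by rewrite !lt_min divr_gt0 ?L0.
have ce : c <= e / 4 by rewrite ge_min lexx.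
have cL : c <= L by rewrite !ge_min lexx orbT.
have cs1 : c <= s1 by rewrite !ge_min lexx !orbT.
pose l1 := s1 - c / 2.
have l1_gt0 : 0 < l1 by rewrite /l1; lra.
have l1_itv : s1 - c < l1 < s1 by rewrite /l1; apply/andP; split; lra.
(* With [l1] fixed, only [l0 = - t] is adjusted. The margin [c / 2] makes the interval positive even
   when [s0 = 0], and puts [l0] strictly below [s0]. *)
have [t t_itv irr] : exists2 t : R, - s0 + c / 2 < t < - s0 + c &
    forall m n : nat, (0 < n)%N -> n%:R * l1 != m%:R * t.
  by apply: irrational_ratio_dense => //; apply/andP; split; lra.
pose l0 := - t; have /andP[t1 t2] := t_itv.
have l0_itv : s0 - c < l0 < s0 by rewrite /l0; apply/andP; split; lra.
have [g0 [hg0 D00 D01 [[d0 d00 lin0] g0_itv dg0]]] :=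
  CI_flatten (rds0_homeo f) c0 l0_itv.
have [g1 [hg1 D10 D11 [[d1 d10 lin1] g1_itv dg1]]] :=
  CI_flatten (rds1_homeo f) c0 l1_itv.
have g0_lt x : 0 < x < 1 -> g0 x < x.
  move=> x01; have /andP[_ h] := g0_itv _ x01.
  apply: (le_lt_trans h); exact: rds0_lt.
(* Flattening lowers the map, but not below the line of slope e^l1 > 1 where it is changed, so it
   stays above the diagonal. *)
have g1_gt x : 0 < x < 1 -> x < g1 x.
  move=> x01; have /andP[h _] := g1_itv _ x01; apply: lt_le_trans h.
  rewrite lt_min rds1_gt//= ltr_pMl; last by case/andP: x01.
  by rewrite -expR0 ltr_expR.
have Lam0 : 0 < p * ln (derive_at0 g0) + (1 - p) * ln (derive_at0 g1).
  rewrite D00 D10 !expRK; have /andP[h0 _] := l0_itv; have /andP[h1 _] := l1_itv.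
  have : p * (s0 - c) < p * l0 by rewrite ltr_pM2l.
  have : (1 - p) * (s1 - c) < (1 - p) * l1 by rewrite ltr_pM2l// subr_gt0.
  by move: cL; rewrite /L; lra.
have Lam1 : 0 < p * ln (derive_at1 g0) + (1 - p) * ln (derive_at1 g1).
  by rewrite D01 D11; exact: rds_Lambda1 f.
pose g := MkRDS hg0 hg1 g0_lt g1_gt (rdsp_itv f) Lam0 Lam1.
exists g, (Num.min (1 / 2) (Num.min d0 d1)), l0, l1; split.
- have small : ((2 * c)%:E < e%:E)%E by rewrite lte_fin; lra.
  rewrite /dm /= !gt_max subrr normr0 lte_fin e_gt0 andbT.
  by rewrite (le_lt_trans dg0 small) (le_lt_trans dg1 small).
- rewrite !lt_min d00 d10 gt_min; apply/andP; split; last by apply/orP; left; lra.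
  by rewrite !andbT; lra.
- by rewrite l1_gt0 andbT /l0; lra.
- by move=> m n n0; rewrite opprK; exact: irr.
- move=> x; rewrite !lt_min => /andP[x0 /and3P[_ xd0 xd1]].
  by rewrite /= lin0 ?lin1 ?x0.
Qed.

End Density.

Theorem theorem4p6 (R : realType) :
  dense [set f : RDS R |
    exists2 mu : probability (measurableTypeR R) R,
      unique_stationary f mu & full_support mu].
Proof.
move=> O [f Of] oO.
have /nbhs_ballP[e /= e_gt0 ballO] : nbhs f O by exact: open_nbhs_nbhs.
have [g [d [l0 [l1 [fg /andP[d0 d1] /andP[l0_lt0 l1_gt0] irr lin]]]]] :=
  locally_linear_approximation f e_gt0.
exists g; split; first exact: ballO.
have [mu mu_unique] := unique_stationary_exists g.
exists mu => //; have [mu_stat _] := mu_unique.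
have [G0 [K0 e0]] := CI_extension (rds0_homeo g).
have [G1 [K1 e1]] := CI_extension (rds1_homeo g).
have itv (x : R) : 0 < x < d -> 0 <= x <= 1.
  by move=> /andP[x0 xd]; rewrite !ltW// (lt_trans xd).
apply: (stationary_full_support e0 e1 d0 l0_lt0 l1_gt0 _ _ irr mu_stat) => x xd.
  by have [_ Gg _] := e0; rewrite Gg ?itv//; case: (lin _ xd).
by have [_ Gg _] := e1; rewrite Gg ?itv//; case: (lin _ xd).
Qed.
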